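(* Suppose that $a_1,a_2,a_3$ are distinct elements of $\mathbb{F}_q$. Let $F_1=\mathbb{F}_q(x,y_1)$ and $F_2=\mathbb{F}_q(x,y_2)$ be function fields defined by the equations $$y_1^m=\frac{(x-a_1)(x-a_2)}{x-a_3}\qquad\text{and}\qquad y_2^m=\frac{x-a_3}{(x-a_1)(x-a_2)},$$ respectively. Then both $F_1/\mathbb{F}_q$ and $F_2/\mathbb{F}_q$ are $m$-friendly algebraic function fields.
   Context: Here $q$ is a prime power, $m$ is a positive integer, $v_P$ is the discrete valuation at a place $P$ of a function field, $(z)_\infty$ is the pole divisor of $z$, and $g(F)$ is the genus of $F$. Definition. An $m$-friendly algebraic function field is a function field $F/\mathbb{F}_q$ with a place $Q$ of $F/\mathbb{F}_q$ such that: (1) the genus is $g(F)=m-1$; (2) there exists $z_1\in F$ with $v_Q(z_1)=1$ and $\deg((z_1)_\infty)=2$.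
   Formalization: The formal theorem adds the hypothesis gcd(m,q)=1, without which the claim is false: if m = p^k n with p the characteristic, k ≥ 1 and p not dividing n, both fields have genus n-1 instead of m-1 (for q = m = 3, genus 0, not 2). *)

(* Defs.v *)
From HB Require Import structures.
From mathcomp Require Import all_boot all_order all_algebra finmap.
From mathcomp Require Import boolp classical_sets functions cardinality fsbigop.
From mathcomp Require Import constructive_ereal.

Set Implicit Arguments.
Unset Strict Implicit.
Unset Printing Implicit Defensive.
Import Order.TTheory GRing.Theory Num.Theory.
Local Open Scope classical_set_scope.
Local Open Scope ring_scope.

(* Algebraic function fields of one variable F/K, where the extension is given *)
(* by an embedding iota : K -> F (see H. Stichtenoth, Algebraic Function       *)
(* Fields and Codes, Chapter 1).                                               *)
Section FunctionField.
Context {K F : fieldType} (iota : {rmorphism K -> F}).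

Definition transcendental (x : F) : Prop := ~ algebraicOver iota x.

Definition in_rational_subfield (x z : F) : Prop :=
  exists p q : {poly K},
    (map_poly iota q).[x] != 0 /\ z = (map_poly iota p).[x] / (map_poly iota q).[x].

(* F = K(x, y): the only subfield of F containing K, x and y is F itself. *)
Definition generated_by (x y : F) : Prop :=
  forall S : {pred F}, divring_closed S ->
    (forall c : K, iota c \in S) -> x \in S -> y \in S -> forall z : F, z \in S.

(* F is a finite extension of K(x) for some x transcendental over K, and K is  *)
(* the full constant field of F, i.e. it is algebraically closed in F.         *)
Definition function_field : Prop :=
  (exists x : F, transcendental x /\
     exists (n : nat) (e : 'I_n -> F), forall z : F,
       exists c : 'I_n -> F, (forall i, in_rational_subfield x (c i)) /\
                             z = \sum_(i < n) c i * e i) /\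
  (forall z : F, algebraicOver iota z -> exists c : K, z = iota c).

Definition discrete_valuation (v : F -> \bar int) : Prop :=
  [/\ forall z, v z = +oo%E <-> z = 0,
      forall z w, v (z * w) = (v z + v w)%E,
      forall z w, (Order.min (v z) (v w) <= v (z + w)%R)%E,
      exists z, v z = 1%:E
    & forall c : K, c != 0 -> v (iota c) = 0%E].

(* A place P is represented by its normalized discrete valuation v_P. *)
Record place := Place {
  val_at :> F -> \bar int;
  val_at_valuation : discrete_valuation val_at
}.

HB.instance Definition _ := gen_eqMixin place.
HB.instance Definition _ := gen_choiceMixin place.

(* [quotient_basis U W e]: e induces a K-basis of U / W, for K-subspaces       *)
(* W `<=` U of F.                                                              *)
Definition quotient_basis (U W : set F) (n : nat) (e : 'I_n -> F) : Prop :=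
  [/\ forall i, U (e i),
      forall c : 'I_n -> K, W (\sum_(i < n) iota (c i) * e i) -> forall i, c i = 0
    & forall u, U u -> exists c : 'I_n -> K, W (u - \sum_(i < n) iota (c i) * e i)].

(* dim_K (U / W), with value 0 when U / W is infinite-dimensional. *)
Definition quotient_dim (U W : set F) : nat :=
  xget 0%N [set n | exists e : 'I_n -> F, quotient_basis U W e].

Definition valuation_ring (P : place) : set F := [set z | (0 <= P z)%E].

Definition maximal_ideal (P : place) : set F := [set z | (0 < P z)%E].

Definition place_degree (P : place) : nat :=
  quotient_dim (valuation_ring P) (maximal_ideal P).

Definition is_divisor (A : place -> int) : Prop :=
  finite_set [set P | A P != 0].

(* A sum over a family with infinite support is 0. *)
Definition divisor_degree (A : place -> int) : int :=
  \sum_(P \in [set: place]) A P * (place_degree P)%:Z.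

(* fine +oo = 0, so that pole_divisor 0 = 0. *)
Definition pole_divisor (z : F) : place -> int :=
  fun P => Num.max 0 (- fine (P z)).

(* L(A); it contains 0 because v_P(0) = +oo. *)
Definition riemann_roch_space (A : place -> int) : set F :=
  [set z | forall P : place, ((- A P)%:E <= P z)%E].

Definition riemann_roch_dim (A : place -> int) : nat :=
  quotient_dim (riemann_roch_space A) [set 0].

(* g = max { deg A - l(A) + 1 | A a divisor of F }. *)
Definition is_genus (g : int) : Prop :=
  let d A := divisor_degree A - (riemann_roch_dim A)%:Z + 1 in
  (exists A, is_divisor A /\ d A = g) /\ (forall A, is_divisor A -> d A <= g).

Definition m_friendly (m : nat) : Prop :=
  function_field /\
  exists Q : place,
    is_genus (m%:Z - 1) /\
    exists z1 : F, Q z1 = 1%:E /\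
      is_divisor (pole_divisor z1) /\ divisor_degree (pole_divisor z1) = 2.

End FunctionField.

(* Main.v *)
Require Import Defs.
From mathcomp Require Import all_boot all_order all_algebra.
From mathcomp Require Import boolp classical_sets cardinality fsbigop.
From mathcomp Require Import constructive_ereal.
From mathcomp Require Import zify ring.

(* Put X = x - a3 and b_i = a_i - a3. The equation becomes                     *)
(*   X^2 - (b1 + b2 + y^m) X + b1 b2 = 0,                                      *)
(* so F is a quadratic extension of K(y) and (y)_oo has degree 2. As b1 b2 is  *)
(* a nonzero constant and m is invertible in K, the curve K[y] + K[y] X is     *)
(* nonsingular: the valuations above an irreducible p(y) can be written down   *)
(* (inert, split and ramified case), they are the only ones, and an element of *)
(* F that is regular at all of them lies in K[y] + K[y] X. At infinity the     *)
(* same applies to w = 1/y and X w^m. Hence                                    *)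
(*   L(n (y)_oo) = { f(y) + g(y) X : deg f <= n, deg g <= n - m },             *)
(* of dimension 2n + 2 - m for n >= m - 1, so that n (y)_oo reaches the value  *)
(* m - 1 in the definition of the genus. Every divisor is at most              *)
(* n (y)_oo + (d(y)) for some polynomial d and large n, so no divisor exceeds  *)
(* this value. Take for Q the place y = 0, X = b1, and z1 = y. The second      *)
(* field is the first one with 1/y in place of y.                              *)

Set Implicit Arguments.
Unset Strict Implicit.
Unset Printing Implicit Defensive.
Import Order.TTheory GRing.Theory Num.Theory.
Local Open Scope classical_set_scope.
Local Open Scope ring_scope.

(** * Valuations at places *)

(** A place of F is determined by its centre: a prime of O = K[y] + K[y] X where y is regular, and a
    prime of the analogous ring over K[1/y] where y has a pole. Since the model is nonsingular, each
    localization is a discrete valuation ring whose uniformizer can be written down; so places are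
    constructed from explicit ideals ([center_place]) and recognized by them ([dvr_place_unique]).
    [exists_places_over] lists the places above an irreducible p, with the equality sum of e f = 2
    and the fact that they detect divisibility by p in O. Removing irreducible factors from
    denominators one by one, [integral_elt] shows that O consists of the functions regular wherever
    y is.

    The genus is a maximum, so it needs a value that is attained and an upper bound. Comparing
    coordinates in the charts y and 1/y gives the exact dimension of L(n (y)_oo)
    ([rr_multiple_pole_dim]). The number deg A - l(A) does not decrease when A grows
    ([rr_dim_mono]), and it is unchanged by adding the divisor of a polynomial in y, whose degree is
    0 ([principal_degree]). Hence the divisors n (y)_oo decide the bound ([riemann_inequality]).

    The hypotheses enter as follows: b1 b2 != 0 makes the norm of X a unit of K[y], so that the
    quadratic equation is irreducible; m != 0 in K and b1 != b2 give nonsingularity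
    ([curve_smooth]); b1 != b2 also makes the place y = 0, X = b1 unramified over K(y), so that y
    has order 1 there. *)

Section PlaceBasics.
Variables (K F : fieldType) (iota : {rmorphism K -> F}).
Implicit Types (P : place iota) (z w : F) (n m : int).

(** [fine] sends +oo to 0, so [ord P 0] is 0 and statements about [ord] carry z != 0; [vge] keeps
    v(0) = +oo and is stable under addition. *)
Definition ord P z : int := fine (P z).

Definition vge P n z : bool := (n%:E <= P z)%E.

Lemma place_iota P c : c != 0 -> P (iota c) = 0%E.
Proof. by case: (val_at_valuation P) => _ _ _ _; apply. Qed.

Lemma placeM P z w : P (z * w) = (P z + P w)%E.
Proof. by case: (val_at_valuation P). Qed.

Lemma place0 P : P 0 = +oo%E.
Proof. by case: (val_at_valuation P) => h _ _ _ _; apply/h. Qed.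

Lemma place1 P : P 1 = 0%E.
Proof. by rewrite -(rmorph1 iota) place_iota ?oner_eq0. Qed.

(** The value -oo, which [\bar int] contains, is excluded by v(z) + v(1/z) = v(1) = 0. *)
Lemma place_ord P z : z != 0 -> P z = (ord P z)%:E.
Proof.
move=> z0; rewrite /ord fineK // fin_numE; apply/andP; split; apply/eqP => Pz.
- have := placeM P z z^-1; rewrite mulfV // place1 Pz.
  by rewrite addNye.
- by case: (val_at_valuation P) => /(_ z) [h _] _ _ _ _; rewrite (h Pz) eqxx in z0.
Qed.

Lemma ordM P z w : z != 0 -> w != 0 -> ord P (z * w) = ord P z + ord P w.
Proof.
move=> z0 w0; have := placeM P z w.
by rewrite !place_ord ?mulf_neq0 // => -[].
Qed.

Lemma ord_one P : ord P 1 = 0.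
Proof. by rewrite /ord place1. Qed.

Lemma ordV P z : ord P z^-1 = - ord P z.
Proof.
have [->|z0] := eqVneq z 0; first by rewrite invr0 /ord place0.
have := ord_one P; rewrite -(mulVf z0) ordM ?invr_eq0 // => h; lia.
Qed.

Lemma ordX P z k : ord P (z ^+ k) = ord P z *+ k.
Proof.
have [->|z0] := eqVneq z 0.
  case: k => [|k]; first by rewrite expr0 ord_one.
  by rewrite expr0n /= /ord place0 mul0rn.
elim: k => [|k IH]; first by rewrite expr0 ord_one.
by rewrite exprS ordM ?expf_neq0 // IH mulrS.
Qed.

Lemma ord_iota P c : ord P (iota c) = 0.
Proof.
by have [->|c0] := eqVneq c 0; rewrite /ord ?rmorph0 ?place0 ?place_iota.
Qed.

Lemma ord_surj P : exists2 z, z != 0 & ord P z = 1.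
Proof.
case: (val_at_valuation P) => _ _ _ [z Pz] _; exists z; last by rewrite /ord Pz.
by apply: contra_eq_neq Pz => ->; rewrite place0.
Qed.

Lemma place_ext P P' : (forall z, z != 0 -> ord P z = ord P' z) -> P = P'.
Proof.
move=> h; have : val_at P = val_at P'.
  apply/funext => z; have [->|z0] := eqVneq z 0; first by rewrite !place0.
  by rewrite !place_ord // h.
case: P {h} => v hv; case: P' => v' hv' /= e; move: hv'; rewrite -e => hv'.
by congr Place; apply: Prop_irrelevance.
Qed.

Lemma vge_ord P n z : z != 0 -> vge P n z = (n <= ord P z).
Proof. by move=> z0; rewrite /vge place_ord. Qed.

Lemma vge0 P n : vge P n 0.
Proof. by rewrite /vge place0 leey. Qed.

Lemma vgeP P n z : reflect (z != 0 -> n <= ord P z) (vge P n z).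
Proof.
have [->|z0] := eqVneq z 0; first by rewrite vge0; left.
by rewrite vge_ord //; apply: (iffP idP); auto.
Qed.

Lemma vge_ordE P z : vge P (ord P z) z.
Proof. by apply/vgeP. Qed.

Lemma vge_trans P n m z : m <= n -> vge P n z -> vge P m z.
Proof. by move=> mn; rewrite /vge; apply: le_trans; rewrite lee_fin. Qed.

Lemma vgeM P n m z w : vge P n z -> vge P m w -> vge P (n + m) (z * w).
Proof. by move=> h1 h2; rewrite /vge placeM EFinD; apply: leeD. Qed.

Lemma vgeMl P n m z w : z != 0 -> ord P z = m -> vge P n (z * w) = vge P (n - m) w.
Proof.
move=> z0 <-; have [->|w0] := eqVneq w 0; first by rewrite mulr0 !vge0.
by rewrite !vge_ord ?mulf_neq0 // ordM // lerBlDl.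
Qed.

Lemma vgeD P n z w : vge P n z -> vge P n w -> vge P n (z + w).
Proof.
case: (val_at_valuation P) => _ _ h _ _; rewrite /vge => h1 h2.
by apply: le_trans (h z w); rewrite le_min h1.
Qed.

Lemma vge_iota P c : vge P 0 (iota c).
Proof. by apply/vgeP => _; rewrite ord_iota. Qed.

Lemma vgeZ P n c z : vge P n z -> vge P n (iota c * z).
Proof. by move=> h; rewrite -[n]add0r; apply: vgeM => //; apply: vge_iota. Qed.

Lemma vgeN P n z : vge P n z -> vge P n (- z).
Proof. by move/(vgeZ (-1)); rewrite rmorphN1 mulN1r. Qed.

Lemma vgeB P n z w : vge P n z -> vge P n w -> vge P n (z - w).
Proof. by move=> h1 h2; apply: vgeD => //; apply: vgeN. Qed.

Lemma vge_sum P n (I : Type) (r : seq I) (Q : pred I) (f : I -> F) :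
  (forall i, Q i -> vge P n (f i)) -> vge P n (\sum_(i <- r | Q i) f i).
Proof. by move=> h; elim/big_ind: _; [exact: vge0|exact: vgeD|]. Qed.

Lemma vgeX P n z k : vge P n z -> vge P (n *+ k) (z ^+ k).
Proof.
move=> h; elim: k => [|k IH]; first by rewrite expr0 -(rmorph1 iota) vge_iota.
by rewrite exprS mulrS; apply: vgeM.
Qed.

Lemma vgeX0 P z k : vge P 0 z -> vge P 0 (z ^+ k).
Proof. by move=> h; rewrite -(mul0rn _ k); apply: vgeX. Qed.

Lemma horner_map_sum (p : {poly K}) z :
  (map_poly iota p).[z] = \sum_(i < size p) iota p`_i * z ^+ i.
Proof.
rewrite horner_coef size_map_poly; apply: eq_bigr => i _.
by rewrite coef_map.
Qed.

Lemma vge_poly P (p : {poly K}) z : vge P 0 z -> vge P 0 (map_poly iota p).[z].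
Proof.
move=> h; rewrite horner_map_sum; apply: vge_sum => i _.
by apply: vgeZ; apply: vgeX0.
Qed.

(** If z + w had larger order than z, then so would z = (z + w) - w. The condition on w is a [vge],
    so that w = 0 is covered. *)
Lemma ordD_eq P z w : z != 0 -> vge P (ord P z + 1) w -> z + w != 0 /\ ord P (z + w) = ord P z.
Proof.
move=> z0 hw; have zw0 : z + w != 0.
  apply/eqP => zw; move: hw; have -> : w = - z by apply/eqP; rewrite -addr_eq0 addrC zw.
  move/vgeN; rewrite opprK vge_ord // => ?; lia.
split => //; apply/eqP; rewrite eq_le; apply/andP; split; last first.
  rewrite -vge_ord //; apply: vgeD; first exact: vge_ordE.
  by apply: vge_trans hw; lia.
rewrite leNgt; apply/negP => lt.
have : vge P (ord P z + 1) z.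
  rewrite -{2}(addrK w z); apply: vgeB => //.
  by rewrite vge_ord // lezD1.
rewrite vge_ord // => ?; lia.
Qed.

Lemma maximal_idealE P z : maximal_ideal P z <-> vge P 1 z.
Proof.
rewrite /maximal_ideal /=; have [->|z0] := eqVneq z 0.
  by split => _; [exact: vge0|rewrite place0 ltey].
by rewrite vge_ord // place_ord // lte_fin.
Qed.

End PlaceBasics.

(** * Dimensions of quotients *)

Section LinearAlgebra.
Variables (K F : fieldType) (iota : {rmorphism K -> F}).
Implicit Types (U V W : set F).

Definition subspace U : Prop :=
  [/\ U 0, forall u v, U u -> U v -> U (u + v) & forall c u, U u -> U (iota c * u)].

Definition comb n (c : 'I_n -> K) (e : 'I_n -> F) : F := \sum_(i < n) iota (c i) * e i.

Definition indep W n (e : 'I_n -> F) : Prop :=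
  forall c, W (comb c e) -> forall i, c i = 0.

Definition isdim U W n : Prop := exists e : 'I_n -> F, quotient_basis iota U W e.

Lemma subspaceB U u v : subspace U -> U u -> U v -> U (u - v).
Proof.
case=> _ hD hZ hu hv; apply: hD => //.
by rewrite -mulN1r -(rmorphN1 iota); apply: hZ.
Qed.

Lemma subspace_sum U n (f : 'I_n -> F) :
  subspace U -> (forall i, U (f i)) -> U (\sum_(i < n) f i).
Proof. by case=> h0 hD _ hf; elim/big_ind: _. Qed.

Lemma subspace_comb U n c (e : 'I_n -> F) :
  subspace U -> (forall i, U (e i)) -> U (comb c e).
Proof. by move=> hU he; apply: subspace_sum => // i; case: hU => _ _; apply. Qed.

Lemma combZ n c (e : 'I_n -> F) z : comb c (fun i => z * e i) = z * comb c e.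
Proof. by rewrite /comb mulr_sumr; apply: eq_bigr => i _; rewrite mulrCA. Qed.

(** Steinitz exchange modulo W: the matrix expressing u in terms of e has more rows than columns,
    and a nonzero vector of its left kernel is a linear dependence of u modulo W. *)
Lemma exchange W a b (u : 'I_a -> F) (e : 'I_b -> F) :
  subspace W -> (b < a)%N ->
  (forall j, exists c, W (u j - comb c e)) ->
  exists c, W (comb c u) /\ exists i, c i != 0.
Proof.
move=> hW ba /choice[C hC].
pose M : 'M[K]_(a, b) := \matrix_(j, i) C j i.
have /rowV0Pn[v /sub_kermxP vM v0] : kermx M != 0.
  rewrite -mxrank_eq0 mxrank_ker subn_eq0 -ltnNge.
  by apply: leq_ltn_trans ba; apply: rank_leq_col.
exists (fun j => v 0 j); split; last first.
  apply: contrapT => h; move/eqP: v0; apply; apply/rowP => j; rewrite mxE.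
  by apply/eqP/negPn/negP => hj; apply: h; exists j.
have -> : comb (v 0) u = \sum_j iota (v 0 j) * (u j - comb (C j) e).
  rewrite /comb; under [RHS]eq_bigr do rewrite mulrBr.
  rewrite sumrB -[LHS]subr0; congr (_ - _); symmetry.
  under eq_bigr do rewrite mulr_sumr; rewrite exchange_big big1 //= => i _.
  transitivity (iota ((v *m M) 0 i) * e i); last by rewrite vM mxE rmorph0 mul0r.
  rewrite mxE rmorph_sum mulr_suml; apply: eq_bigr => j _.
  by rewrite mxE rmorphM mulrA.
by apply: subspace_sum => // j; case: hW => _ _; apply.
Qed.

Lemma indep_le U W n m (e : 'I_n -> F) (u : 'I_m -> F) : subspace W ->
  quotient_basis iota U W e -> (forall i, U (u i)) -> indep W u -> (m <= n)%N.
Proof.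
move=> hW [_ _ he] hu ind; rewrite leqNgt; apply/negP => lt.
have [|c [Wc [i ci]]] := exchange (u := u) (e := e) hW lt.
  by move=> j; apply: he.
by rewrite (ind c Wc i) eqxx in ci.
Qed.

Lemma dim_unique U W n m : subspace W -> isdim U W n -> isdim U W m -> n = m.
Proof.
move=> hW [e he] [u hu]; apply/eqP; rewrite eqn_leq; apply/andP; split.
- by case: (he) => h1 h2 _; apply: (indep_le hW hu h1 h2).
- by case: (hu) => h1 h2 _; apply: (indep_le hW he h1 h2).
Qed.

Lemma quotient_dimE U W n : subspace W -> isdim U W n -> quotient_dim iota U W = n.
Proof.
move=> hW h; rewrite /quotient_dim; apply: xget_unique => // m hm.
exact: dim_unique hm h.
Qed.

Definition cat_fam a b (e : 'I_a -> F) (f : 'I_b -> F) (i : 'I_(a + b)) : F :=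
  match fintype.split i with inl j => e j | inr k => f k end.

Lemma cat_faml a b (e : 'I_a -> F) (f : 'I_b -> F) i : cat_fam e f (lshift b i) = e i.
Proof. by rewrite /cat_fam (unsplitK (inl i)). Qed.

Lemma cat_famr a b (e : 'I_a -> F) (f : 'I_b -> F) i : cat_fam e f (rshift a i) = f i.
Proof. by rewrite /cat_fam (unsplitK (inr i)). Qed.

Lemma comb_cat a b c (e : 'I_a -> F) (f : 'I_b -> F) :
  comb c (cat_fam e f) =
  comb (fun i => c (lshift b i)) e + comb (fun i => c (rshift a i)) f.
Proof.
rewrite /comb big_split_ord; congr (_ + _); apply: eq_bigr => i _.
- by rewrite cat_faml.
- by rewrite cat_famr.
Qed.

Lemma cat_famP a b (e : 'I_a -> F) (f : 'I_b -> F) (Q : F -> Prop) :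
  (forall i, Q (e i)) -> (forall i, Q (f i)) -> forall i, Q (cat_fam e f i).
Proof. by move=> he hf i; rewrite /cat_fam; case: fintype.split. Qed.

Lemma split_comb a b (c : 'I_a -> K) (d : 'I_b -> K) :
  exists g : 'I_(a + b) -> K, (forall i, g (lshift b i) = c i) /\ (forall i, g (rshift a i) = d i).
Proof.
exists (fun i => match fintype.split i with inl j => c j | inr k => d k end).
by split=> i; rewrite ?(unsplitK (inl i)) ?(unsplitK (inr i)).
Qed.

Lemma eq_comb n (c d : 'I_n -> K) (e : 'I_n -> F) : c =1 d -> comb c e = comb d e.
Proof. by move=> h; apply: eq_bigr => i _; rewrite h. Qed.

Lemma indep_extend W n (e : 'I_n -> F) u : subspace W -> indep W e ->
  (forall c, ~ W (u - comb c e)) -> indep W (cat_fam e (fun _ : 'I_1 => u)).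
Proof.
move=> hW ind hc c; rewrite comb_cat => hW'.
have c1 : c (rshift n 0) = 0.
  apply: contrapT => /eqP c1; apply: (hc (fun i => - (c (rshift n 0))^-1 * c (lshift 1 i))).
  case: (hW) => _ _ /(_ (c (rshift n 0))^-1 _ hW').
  rewrite {2}/comb big_ord1 mulrDr mulrA -rmorphM mulVf // rmorph1 mul1r.
  congr (W _); rewrite addrC /comb mulr_sumr -sumrN; congr (_ + _).
  by apply: eq_bigr => i _; rewrite mulrA -rmorphM mulNr rmorphN mulNr opprK.
have hl : forall i, c (lshift 1 i) = 0.
  apply: ind; move: hW'; rewrite {2}/comb big_ord1 c1 rmorph0 mul0r addr0.
  exact.
move=> i; case: (splitP i) => [j ij|j ij].
  by rewrite (_ : i = lshift 1 j) ?hl //; apply: val_inj.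
by rewrite (_ : i = rshift n 0) ?c1 //; apply: val_inj; rewrite /= ij (ord1 j).
Qed.

(** An independent family that does not span can be enlarged by one element, and N bounds the number
    of enlargements; the induction is on the room N - n that is left. *)
Lemma dim_bounded U W N : subspace U -> subspace W ->
  (forall n (e : 'I_n -> F), (forall i, U (e i)) -> indep W e -> (n <= N)%N) ->
  exists2 k, (k <= N)%N & isdim U W k.
Proof.
move=> hU hW hN.
suff : forall d n (e : 'I_n -> F), (N - n < d)%N -> (forall i, U (e i)) -> indep W e ->
    exists2 k, (k <= N)%N & isdim U W k.
  by move/(_ N.+1 0%N (fun=> 0)); apply => [|[]//|c _ []//]; rewrite subn0.
elim=> [//|d IH] n e hd he ind.
have [hc|] := pselect (forall u, U u -> exists c, W (u - comb c e)).
  by exists n; [exact: hN ind|exists e].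
move=> /existsNP[u] /not_implyP[hu /forallNP hc].
have hU' : forall i, U (cat_fam e (fun _ : 'I_1 => u) i) by apply: cat_famP.
have ind' := indep_extend hW ind hc.
by apply: (IH _ _ _ hU' ind'); have := hN _ _ hU' ind'; lia.
Qed.

(** Multiplication by z induces an injection of V / W' into U / W. *)
Lemma dim_inject U W V W' n z : subspace W -> subspace V -> subspace W' ->
  isdim U W n -> (forall v, V v -> U (z * v)) -> (forall v, V v -> W (z * v) -> W' v) ->
  exists2 k, (k <= n)%N & isdim V W' k.
Proof.
move=> hW hV hW' [e he] h1 h2; apply: dim_bounded => // m u hu ind.
apply: (indep_le (u := fun i => z * u i) hW he) => [i|c]; first exact: h1.
by rewrite combZ => /h2 h; apply: ind; apply: h; apply: subspace_comb.
Qed.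

Lemma dim_add U V W a b : subspace U -> subspace V -> W `<=` V -> V `<=` U ->
  isdim U V a -> isdim V W b -> isdim U W (a + b).
Proof.
move=> hU hV WV VU [e [e1 e2 e3]] [f [f1 f2 f3]].
exists (cat_fam e f); split.
- by apply: cat_famP => // i; apply: VU.
- move=> c; rewrite -/(comb _ _) comb_cat => hc.
  have hl : forall i, c (lshift b i) = 0.
    apply: e2; rewrite -/(comb _ _).
    rewrite -[comb _ e](addrK (comb (fun i => c (rshift a i)) f)).
    by apply: subspaceB => //; [exact: WV|exact: subspace_comb].
  have hr : forall i, c (rshift a i) = 0.
    apply: f2; move: hc; rewrite {1}/comb big1 ?add0r // => i _.
    by rewrite hl rmorph0 mul0r.
  move=> i; case: (splitP i) => j ij.
    by rewrite (_ : i = lshift b j) ?hl //; apply: val_inj.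
  by rewrite (_ : i = rshift a j) ?hr //; apply: val_inj.
- move=> u /e3[c hc]; have [d hd] := f3 _ hc.
  have [g [gl gr]] := split_comb c d.
  exists g; rewrite -/(comb _ _) comb_cat opprD addrA.
  by rewrite (eq_comb _ gl) (eq_comb _ gr).
Qed.

Lemma dim_scale U W U' W' n z : z != 0 ->
  (forall u, U' (z * u) <-> U u) -> (forall u, W' (z * u) <-> W u) ->
  isdim U W n -> isdim U' W' n.
Proof.
move=> z0 hU hW [e [e1 e2 e3]]; exists (fun i => z * e i); split.
- by move=> i; apply/hU.
- by move=> c; rewrite -/(comb _ _) combZ => /hW; apply: e2.
- move=> u; rewrite -[u](mulVKf z0) => /hU /e3[c hc]; exists c.
  by rewrite -/(comb _ _) combZ -mulrBr; apply/hW.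
Qed.

End LinearAlgebra.

(** * Discrete valuation rings *)

Section DiscreteValuationRing.
Variables (K F : fieldType) (iota : {rmorphism K -> F}).

(* I is a prime ideal of the domain R with fraction field F, and t generates   *)
(* the maximal ideal of the localization of R at I, which is a DVR.            *)
Record dvr_data (R I : set F) (t : F) : Prop := DvrData {
  dvr_iota : forall c, R (iota c);
  dvr_add : forall a b, R a -> R b -> R (a + b);
  dvr_mul : forall a b, R a -> R b -> R (a * b);
  dvr_sub : I `<=` R;
  dvr_idealD : forall a b, I a -> I b -> I (a + b);
  dvr_idealM : forall a b, R a -> I b -> I (a * b);
  dvr_prime : forall a b, R a -> R b -> ~ I a -> ~ I b -> ~ I (a * b);
  dvr_one : ~ I 1;
  dvr_t : I t;
  dvr_t0 : t != 0;
  dvr_fact : forall r, R r -> r != 0 ->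
    exists (n : nat) a b, [/\ R a, ~ I a, R b, ~ I b & r * b = t ^+ n * a];
  dvr_frac : forall z, exists a b, [/\ R a, R b, b != 0 & z = a / b]
}.

Variables (R I : set F) (t : F).
Hypothesis D : dvr_data R I t.

Definition local_unit (u : F) : Prop :=
  exists a b, [/\ R a, ~ I a, R b, ~ I b & u = a / b].

Lemma dvr_notI_neq0 a : ~ I a -> a != 0.
Proof.
move=> ha; apply/eqP => a0; apply: ha; rewrite a0 -(mul0r t).
by apply: (dvr_idealM D) (dvr_t D); rewrite -(rmorph0 iota); apply: (dvr_iota D).
Qed.

Lemma dvr_R1 : R 1.
Proof. by rewrite -(rmorph1 iota); apply: (dvr_iota D). Qed.

Lemma local_unit_neq0 u : local_unit u -> u != 0.
Proof.
by case=> a [b [_ ha _ hb ->]]; rewrite mulf_neq0 ?invr_eq0 ?dvr_notI_neq0.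
Qed.

Lemma local_unitM u v : local_unit u -> local_unit v -> local_unit (u * v).
Proof.
move=> [a [b [Ra ha Rb hb ->]]] [c [d [Rc hc Rd hd ->]]]; exists (a * c), (b * d).
by split; [exact: (dvr_mul D)|exact: (dvr_prime D)|exact: (dvr_mul D)
  |exact: (dvr_prime D)|rewrite invfM mulrACA].
Qed.

Lemma local_unitV u : local_unit u -> local_unit u^-1.
Proof.
by move=> [a [b [Ra ha Rb hb ->]]]; exists b, a; split; rewrite ?invf_div.
Qed.

Lemma dvr_ideal_power n r : R r -> I (t ^+ n.+1 * r).
Proof.
move=> hr; elim: n => [|n IH]; first by rewrite expr1 mulrC; apply: (dvr_idealM D) (dvr_t D).
by rewrite exprS -mulrA; apply: (dvr_idealM D) IH; apply: (dvr_sub D); apply: (dvr_t D).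
Qed.

Lemma local_unit_power n u v : local_unit u -> local_unit v -> u = t ^ n * v -> n <= 0.
Proof.
move=> hu hv e; rewrite leNgt; apply/negP => n0.
have [a [b [Ra ha Rb hb e']]] := local_unitM hu (local_unitV hv).
have v0 := local_unit_neq0 hv.
case: n n0 e => [[|n]|n] // _ e; apply: ha; have b0 := dvr_notI_neq0 hb.
have -> : a = t ^+ n.+1 * b by rewrite -(divfK b0 a) -e' e mulfK.
exact: dvr_ideal_power.
Qed.

Lemma local_unit_power_inj n m u v : local_unit u -> local_unit v ->
  t ^ n * u = t ^ m * v -> n = m.
Proof.
have t0 := dvr_t0 D.
suff h : forall n m u v, local_unit u -> local_unit v -> t ^ n * u = t ^ m * v -> m - n <= 0.
  move=> hu hv e; have := h _ _ _ _ hu hv e; have := h _ _ _ _ hv hu (esym e); lia.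
move=> {n m u v} n m u v hu hv e; apply: (local_unit_power hu hv).
apply: (@mulfI _ (t ^ n)); first by rewrite expfz_neq0.
by rewrite e mulrA -expfzDr // addrC subrK.
Qed.

Lemma dvr_decomp z : z != 0 -> exists n u, local_unit u /\ z = t ^ n * u.
Proof.
have t0 := dvr_t0 D; have [a [b [Ra Rb b0 ->]]] := dvr_frac D z => ab0.
have a0 : a != 0 by apply: contraNneq ab0 => ->; rewrite mul0r.
have [n [a1 [a2 [Ra1 ha1 Ra2 ha2 ea]]]] := dvr_fact D Ra a0.
have [m [b1 [b2 [Rb1 hb1 Rb2 hb2 eb]]]] := dvr_fact D Rb b0.
exists (n%:Z - m%:Z), ((a1 / a2) / (b1 / b2)); split.
  by apply: local_unitM; [exists a1, a2|apply: local_unitV; exists b1, b2].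
have := dvr_notI_neq0 ha1; have := dvr_notI_neq0 ha2.
have := dvr_notI_neq0 hb1; have := dvr_notI_neq0 hb2 => b20 b10 a20 a10.
have -> : a = t ^+ n * a1 / a2 by rewrite -ea mulfK.
have -> : b = t ^+ m * b1 / b2 by rewrite -eb mulfK.
rewrite expfzDr // -exprnN -!exprnP; field.
by rewrite a20 b10 b20 expf_neq0.
Qed.

Definition dvr_val (z : F) : \bar int :=
  if z == 0 then +oo%E else (xget 0 [set n | exists u, local_unit u /\ z = t ^ n * u])%:E.

Lemma dvr_valE n u : local_unit u -> dvr_val (t ^ n * u) = n%:E.
Proof.
move=> hu; rewrite /dvr_val mulf_eq0 expfz_eq0 (negPf (dvr_t0 D)) andbF /=.
rewrite (negPf (local_unit_neq0 hu)); congr _%:E; apply: xget_unique; first by exists u.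
by move=> m [v [hv /local_unit_power_inj]] => /(_ hu hv).
Qed.

(** The ultrametric inequality: once t^n is taken out, what remains is r / (b d) with r in R, and
    [dvr_fact] gives r a nonnegative exponent. *)
Lemma dvr_val_le n m u v : local_unit u -> local_unit v -> n <= m ->
  (n%:E <= dvr_val (t ^ n * u + t ^ m * v)%R)%E.
Proof.
have t0 := dvr_t0 D.
move=> [a [b [Ra ha Rb hb ->]]] [c [d [Rc hc Rd hd ->]]] nm.
have b0 := dvr_notI_neq0 hb; have d0 := dvr_notI_neq0 hd.
have [k ->] : exists k : nat, m = n + k%:Z by exists `|m - n|%N; lia.
set r := a * d + t ^+ k * c * b.
have -> : t ^ n * (a / b) + t ^ (n + k%:Z) * (c / d) = t ^ n * (r / (b * d)).
  by rewrite expfzDr // -exprnP /r; field; rewrite ?b0 ?d0.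
have Rr : R r.
  apply: (dvr_add D); first exact: (dvr_mul D).
  rewrite -mulrA; case: k @r => [|k] r; first by rewrite mul1r; apply: (dvr_mul D).
  by apply: (dvr_sub D); apply: dvr_ideal_power; apply: (dvr_mul D).
have [->|r0] := eqVneq r 0; first by rewrite mul0r mulr0 /dvr_val eqxx leey.
have [j [p [q [Rp hp Rq hq e]]]] := dvr_fact D Rr r0.
have q0 := dvr_notI_neq0 hq.
have -> : t ^ n * (r / (b * d)) = t ^ (n + j%:Z) * (p / (q * (b * d))).
  rewrite expfzDr // -exprnP -(mulfK q0 r) e; field.
  by rewrite ?q0 ?b0 ?d0.
rewrite dvr_valE ?lee_fin ?lerDl //.
have Rbd : R (b * d) by apply: (dvr_mul D).
have hbd : ~ I (b * d) by apply: (dvr_prime D).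
exists p, (q * (b * d)); split => //; first exact: (dvr_mul D).
exact: (dvr_prime D).
Qed.

Lemma dvr_valuation : discrete_valuation iota dvr_val.
Proof.
have t0 := dvr_t0 D.
have valD z w : z != 0 -> w != 0 -> exists n m u v,
    [/\ local_unit u, local_unit v, z = t ^ n * u & w = t ^ m * v].
  move=> /dvr_decomp[n [u [hu ->]]] /dvr_decomp[m [v [hv ->]]].
  by exists n, m, u, v.
have val0 : dvr_val 0 = +oo%E by rewrite /dvr_val eqxx.
split.
- move=> z; split => [|->//]; apply: contraPP => /eqP/dvr_decomp[n [u [hu ->]]].
  by rewrite dvr_valE.
- move=> z w; have [->|z0] := eqVneq z 0.
    rewrite mul0r val0 addye // /dvr_val; case: ifP => // _.
  have [->|w0] := eqVneq w 0.
    rewrite mulr0 val0 addey // /dvr_val; case: ifP => // _.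
  have [n [m [u [v [hu hv -> ->]]]]] := valD _ _ z0 w0.
  by rewrite mulrACA -expfzDr // !dvr_valE //; apply: local_unitM.
- move=> z w; have [->|z0] := eqVneq z 0.
    by rewrite add0r ge_min lexx orbT.
  have [->|w0] := eqVneq w 0.
    by rewrite addr0 ge_min lexx.
  have [n [m [u [v [hu hv -> ->]]]]] := valD _ _ z0 w0.
  rewrite !dvr_valE //; case: (leP n m) => nm.
    by apply: le_trans (dvr_val_le hu hv nm); rewrite ge_min lexx.
  by rewrite addrC; apply: le_trans (dvr_val_le hv hu (ltW nm)); rewrite ge_min lexx orbT.
- exists t; have u1 : local_unit 1.
    exists 1, 1; split; rewrite ?divr1 //; by [exact: dvr_R1|exact: (dvr_one D)].
  by have := dvr_valE 1 u1; rewrite mulr1 expr1z.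
- move=> c c0; have hc (a : K) : a != 0 -> ~ I (iota a).
    move=> a0 /(dvr_idealM D (dvr_iota D a^-1)); rewrite -rmorphM mulVf // rmorph1.
    exact: (dvr_one D).
  have uc : local_unit (iota c).
    exists (iota c), 1; split; rewrite ?divr1 //;
      by [exact: (dvr_iota D)|exact: hc|exact: dvr_R1|exact: (dvr_one D)].
  by have := dvr_valE 0 uc; rewrite expr0z mul1r.
Qed.

Definition dvr_place : place iota := Place dvr_valuation.

Lemma ord_dvr_place n u : local_unit u -> ord dvr_place (t ^ n * u) = n.
Proof. by move=> hu; rewrite /ord /= dvr_valE. Qed.

Lemma local_unit_notI a : R a -> ~ I a -> local_unit a.
Proof. by exists a, 1; split; rewrite ?divr1 //; [exact: dvr_R1|exact: (dvr_one D)]. Qed.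

Lemma ord_dvr_notI a : R a -> ~ I a -> ord dvr_place a = 0.
Proof.
by move=> Ra ha; have := ord_dvr_place 0 (local_unit_notI Ra ha); rewrite mul1r.
Qed.

Lemma ord_dvr_t : ord dvr_place t = 1.
Proof.
have := ord_dvr_place 1 (local_unit_notI dvr_R1 (dvr_one D)).
by rewrite mulr1 expr1z.
Qed.

Lemma vge_dvr_R r : R r -> vge dvr_place 0 r.
Proof.
move=> Rr; apply/vgeP => r0.
have [n [a [b [Ra ha Rb hb e]]]] := dvr_fact D Rr r0.
have b0 := dvr_notI_neq0 hb.
rewrite -(mulfK b0 r) e -mulrA exprnP ord_dvr_place //.
by exists a, b.
Qed.

Lemma vge_dvr_I r : R r -> I r <-> vge dvr_place 1 r.
Proof.
move=> Rr; have [->|r0] := eqVneq r 0.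
  split=> [_|_]; first exact: vge0.
  by rewrite -(mul0r t); apply: (dvr_idealM D) (dvr_t D); rewrite -(rmorph0 iota); apply: (dvr_iota D).
split => [hr|hr]; last first.
  apply: contrapT => h; move: hr.
  by rewrite vge_ord // ord_dvr_notI.
have [n [a [b [Ra ha Rb hb e]]]] := dvr_fact D Rr r0.
have b0 := dvr_notI_neq0 hb.
rewrite vge_ord // -(mulfK b0 r) e -mulrA exprnP ord_dvr_place; last by exists a, b.
case: n e => [|n] // e; exfalso; apply: ha; rewrite -[a]mul1r -[1](expr0 t) -e mulrC.
exact: (dvr_idealM D).
Qed.

(** Such a P gives t^n u the order n * ord P t. Since a place is normalized, some n satisfies n *
    ord P t = 1, which forces ord P t = 1. *)
Lemma dvr_place_unique (P : place iota) :
  (forall a, R a -> ~ I a -> ord P a = 0) -> 0 < ord P t -> P = dvr_place.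
Proof.
move=> hu ht; have t0 := dvr_t0 D.
have hP n u : local_unit u -> ord P (t ^ n * u) = n * ord P t.
  move=> h; rewrite ordM ?expfz_neq0 // ?(local_unit_neq0 h) //.
  have -> : ord P u = 0.
    case: h => a [b [Ra ha Rb hb ->]].
    by rewrite ordM ?invr_eq0 ?dvr_notI_neq0 // ordV !hu // subrr.
  rewrite addr0; case: n => k; first by rewrite -exprnP ordX -mulr_natl natz.
  by rewrite NegzE -exprnN ordV ordX -mulr_natl natz mulNr.
have t1 : ord P t = 1.
  have [z z0 +] := ord_surj P.
  have [n [u [h ->]]] := dvr_decomp z0.
  rewrite hP //; move: ht; move: (ord P t) => k; clear => k0 e.
  have n0 : 0 < n by nia.
  have ? : k <= n * k by nia.
  lia.
by apply: place_ext => z /dvr_decomp[n [u [h ->]]]; rewrite hP // t1 mulr1 ord_dvr_place.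
Qed.

(* Denominators are invertible modulo I, so residue classes have               *)
(* representatives in R.                                                       *)
Lemma dvr_residue_dim n (e : 'I_n -> F) :
  (forall i, R (e i)) -> (forall c, I (comb iota c e) -> forall i, c i = 0) ->
  (forall r, R r -> exists c, I (r - comb iota c e)) ->
  (forall b, R b -> ~ I b -> exists s, R s /\ I (b * s - 1)) ->
  isdim iota (valuation_ring dvr_place) (maximal_ideal dvr_place) n.
Proof.
move=> Re ind span inv.
have RB a b : R a -> R b -> R (a - b).
  move=> Ra Rb; apply: (dvr_add D) => //; rewrite -mulN1r -(rmorphN1 iota).
  by apply: (dvr_mul D) => //; apply: (dvr_iota D).
have Rc c : R (comb iota c e).
  rewrite /comb; elim/big_ind: _ => [|a b|i _].
  - by rewrite -(rmorph0 iota); apply: (dvr_iota D).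
  - exact: (dvr_add D).
  - by apply: (dvr_mul D) => //; apply: (dvr_iota D).
exists e; split.
- by move=> i; apply: vge_dvr_R.
- by move=> c /maximal_idealE /(vge_dvr_I (Rc c)); apply: ind.
move=> z hz; rewrite /valuation_ring /= in hz.
have [r [b [Rr Rb hb ->]]] : exists r b, [/\ R r, R b, ~ I b & z = r / b].
  have [->|z0] := eqVneq z 0.
    exists 0, 1; split; rewrite ?mul0r //; [|exact: dvr_R1|exact: (dvr_one D)].
    by rewrite -(rmorph0 iota); apply: (dvr_iota D).
  have [k [u [hu e1]]] := dvr_decomp z0.
  have k0 : 0 <= k by move: hz; rewrite e1 dvr_valE // lee_fin.
  case: hu => a [b [Ra ha Rb hb e2]].
  case: k k0 e1 => // k _ e1; exists (t ^+ k * a), b; split => //; last by rewrite e1 e2 mulrA.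
  case: k {e1} => [|k]; first by rewrite mul1r.
  by apply: (dvr_sub D); apply: dvr_ideal_power.
have [s [Rs hs]] := inv b Rb hb; have b0 := dvr_notI_neq0 hb.
have [c hc] := span (r * s) (dvr_mul D Rr Rs); exists c; rewrite -/(comb _ _ _).
apply/maximal_idealE; have -> : r / b - comb iota c e =
    - (r * (b * s - 1) / b) + (r * s - comb iota c e) by field.
apply: vgeD; last by apply/vge_dvr_I => //; apply: RB => //; apply: (dvr_mul D).
apply: vgeN; rewrite -[1]addr0; apply: vgeM; last first.
  by apply/vgeP => _; rewrite ordV ord_dvr_notI.
by apply/vge_dvr_I; [apply: (dvr_sub D)|]; apply: (dvr_idealM D).
Qed.

End DiscreteValuationRing.

(** * Quadratic extensions of K(y) *)

Section PolynomialValues.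
Variables (K F : fieldType) (iota : {rmorphism K -> F}) (y : F).
Implicit Types (p q : {poly K}) (P : place iota).

Definition pval p : F := (map_poly iota p).[y].

Lemma pevD p q : pval (p + q) = pval p + pval q.
Proof. by rewrite /pval rmorphD hornerD. Qed.

Lemma pevM p q : pval (p * q) = pval p * pval q.
Proof. by rewrite /pval rmorphM hornerM. Qed.

Lemma pevN p : pval (- p) = - pval p.
Proof. by rewrite /pval rmorphN hornerN. Qed.

Lemma pevC c : pval c%:P = iota c.
Proof. by rewrite /pval map_polyC hornerC. Qed.

Lemma pev0 : pval 0 = 0.
Proof. by rewrite /pval rmorph0 horner0. Qed.

Lemma pev1 : pval 1 = 1.
Proof. by rewrite /pval rmorph1 hornerC. Qed.

Lemma pev_X : pval 'X = y.
Proof. by rewrite /pval map_polyX hornerX. Qed.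

Lemma pevX p n : pval (p ^+ n) = pval p ^+ n.
Proof. by elim: n => [|n IH]; rewrite ?expr0 ?pev1 // !exprS pevM IH. Qed.

Lemma pevZ c p : pval (c *: p) = iota c * pval p.
Proof. by rewrite -mul_polyC pevM pevC. Qed.

Lemma pev_sum (I : Type) (r : seq I) (Q : pred I) (f : I -> {poly K}) :
  pval (\sum_(i <- r | Q i) f i) = \sum_(i <- r | Q i) pval (f i).
Proof. by apply: (big_morph pval pevD pev0). Qed.

Lemma pev_nat n : pval n%:R = n%:R.
Proof. by rewrite -polyC_natr pevC rmorph_nat. Qed.

Definition pevE := (pevD, pevM, pevN, pevC, pev0, pev1, pev_X, pevX, pevZ, pev_nat).

Lemma vge_pev P p : vge P 0 y -> vge P 0 (pval p).
Proof. exact: vge_poly. Qed.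

(** At a pole of y the leading term dominates; the induction follows the Horner scheme. *)
Lemma ord_pev_pole P p : ord P y < 0 -> p != 0 ->
  pval p != 0 /\ ord P (pval p) = ord P y *+ (size p).-1.
Proof.
move=> hy; have y0 : y != 0 by apply: contraTneq hy => ->; rewrite /ord place0.
elim/poly_ind: p => [|p c IH]; first by rewrite eqxx.
have [->|p0] := eqVneq p 0.
  rewrite mul0r add0r polyC_eq0 size_polyC => c0; rewrite c0 /= mulr0n pevC.
  by rewrite fmorph_eq0 ord_iota.
move=> _; have [hp0 hp] := IH p0; rewrite size_MXaddC (negPf p0) /= !pevE.
have e : ord P (pval p * y) = ord P y *+ size p.
  rewrite ordM // hp -mulrSr prednK // size_poly_gt0 //.
have sp : (0 < size p)%N by rewrite size_poly_gt0.
have [] := @ordD_eq _ _ _ P (pval p * y) (iota c).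
- by rewrite mulf_neq0.
- apply: vge_trans (vge_iota P c).
  rewrite e -mulr_natr natz; nia.
- by rewrite e.
Qed.

Lemma vge_of_pev P p : (1 < size p)%N -> 0 < ord P (pval p) -> vge P 0 y.
Proof.
move=> sp hp; have p0 : p != 0 by apply: contraTneq sp => ->; rewrite size_poly0.
apply/vgeP => y0; rewrite leNgt; apply/negP => hy.
have [_ e] := ord_pev_pole hy p0; move: hp; rewrite e -mulr_natr natz.
have : (0 < (size p).-1)%N by lia.
move: ((size p).-1) => k; nia.
Qed.

(** From a Bezout relation u p + v f = 1: if p and f both had positive order at P, then so would
    1. *)
Lemma ord_pev_coprime P p f : irreducible_poly p -> 0 < ord P (pval p) -> ~~ (p %| f) ->
  pval f != 0 /\ ord P (pval f) = 0.
Proof.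
move=> irp hp hf; have hy := vge_of_pev irp.1 hp.
have /Bezout_eq1_coprimepP[[u v] /= e] : coprimep p f by rewrite irreducible_poly_coprime.
have p1 : vge P 1 (pval p) by apply/vgeP.
have f0 : pval f != 0.
  apply: contraTneq p1 => f0; have := congr1 pval e.
  rewrite !pevE f0 mulr0 addr0 => e1; apply/negP => /(vgeM (vge_pev u hy)).
  by rewrite e1 vge_ord ?oner_eq0 // ord_one.
split => //; apply/eqP; rewrite eq_le -vge_ord // (vge_pev f hy) andbT leNgt.
apply/negP => hf1; have f1 : vge P 1 (pval f) by rewrite vge_ord.
have := vgeD (vgeM (vge_pev u hy) p1) (vgeM (vge_pev v hy) f1).
by rewrite -!pevM -pevD e pev1 add0r vge_ord ?oner_eq0 // ord_one.
Qed.

Lemma poly_primary_part p f : (1 < size p)%N -> f != 0 ->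
  exists k g, f = p ^+ k * g /\ ~~ (p %| g).
Proof.
move=> sp; have [n] := ubnP (size f); elim: n f => // n IH f sf f0.
have [|h] := boolP (p %| f); last by exists 0%N, f; rewrite expr0 mul1r.
case/dvdpP => g fE; have g0 : g != 0 by apply: contraNneq f0 => g0; rewrite fE g0 mul0r.
have p0 : p != 0 by apply: contraTneq sp => ->; rewrite size_poly0.
have [|k [r [gE hr]]] := IH g _ g0.
  move: sf; rewrite fE size_mul //.
  have : (0 < size g)%N by rewrite size_poly_gt0.
  by move: sp; clear; move: (size p) (size g) => a b; lia.
by exists k.+1, r; rewrite exprS fE gE; split => //; ring.
Qed.

End PolynomialValues.

Section QuadraticExtension.
Variables (K F : fieldType) (iota : {rmorphism K -> F}).

(** F is quadratic over K(y), and x is integral over K[y] with trace T and norm N. Elements of F are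
    handled through coordinates in K[y] and a denominator in K[y]. *)
Record quadratic_ext (x y : F) (T N : {poly K}) : Prop := QuadraticExt {
  quad_eq : x ^+ 2 = pval iota y T * x - pval iota y N;
  quad_free : forall f g, pval iota y f + pval iota y g * x = 0 -> f = 0 /\ g = 0;
  quad_gen : forall z, exists f g d,
    d != 0 /\ z = (pval iota y f + pval iota y g * x) / pval iota y d
}.

Variables (x y : F) (T N : {poly K}).
Hypothesis QE : quadratic_ext x y T N.
Implicit Types (f g h p : {poly K}) (P : place iota).

Local Notation pev := (pval iota y).

Definition qelt f g : F := pev f + pev g * x.

(* Coordinates of (f + g x)(f' + g' x). *)
Definition qmul_re f g f' g' := f * f' - g * g' * N.
Definition qmul_im f g f' g' := f * g' + g * f' + g * g' * T.

(** The norm of f + g x from F to K(y); the conjugate of x is T - x. *)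
Definition qnorm f g := f ^+ 2 + f * g * T + g ^+ 2 * N.

(** The minimal polynomial of x evaluated at h, which is also the norm of h - x. Its roots modulo p
    govern the decomposition of p. *)
Definition charpoly_value h := h ^+ 2 - T * h + N.

Lemma eltD f g f' g' : qelt f g + qelt f' g' = qelt (f + f') (g + g').
Proof. by rewrite /qelt !pevE; ring. Qed.

Lemma eltN f g : - qelt f g = qelt (- f) (- g).
Proof. by rewrite /qelt !pevE; ring. Qed.

Lemma eltB f g f' g' : qelt f g - qelt f' g' = qelt (f - f') (g - g').
Proof. by rewrite eltN eltD. Qed.

Lemma eltM f g f' g' : qelt f g * qelt f' g' = qelt (qmul_re f g f' g') (qmul_im f g f' g').
Proof.
rewrite /qelt /qmul_re /qmul_im !pevE.
transitivity (pev f * pev f' + (pev f * pev g' + pev g * pev f') * x + pev g * pev g' * x ^+ 2).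
  by ring.
by rewrite (quad_eq QE); ring.
Qed.

Lemma elt_pev f : qelt f 0 = pev f.
Proof. by rewrite /qelt pev0 mul0r addr0. Qed.

Lemma elt_inj f g f' g' : qelt f g = qelt f' g' -> f = f' /\ g = g'.
Proof.
move/eqP; rewrite -subr_eq0 eltB => /eqP/(quad_free QE)[/eqP + /eqP].
by rewrite !subr_eq0 => /eqP -> /eqP ->.
Qed.

Lemma pev_eq0 f : (pev f == 0) = (f == 0).
Proof.
apply/eqP/eqP => [h|->]; last exact: pev0.
by have [] := quad_free QE (f := f) (g := 0); rewrite ?pev0 ?mul0r ?addr0.
Qed.

Lemma elt_norm f g : qelt f g * qelt (f + g * T) (- g) = pev (qnorm f g).
Proof.
rewrite eltM -elt_pev /qmul_re /qmul_im /qnorm; congr qelt; ring.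
Qed.

Lemma norm_neq0 f g : qelt f g != 0 -> qnorm f g != 0.
Proof.
move=> h; rewrite -pev_eq0 -elt_norm mulf_neq0 //; apply: contraNneq h.
move=> h'; have /elt_inj[e /eqP] : qelt (f + g * T) (- g) = qelt 0 0 by rewrite h' elt_pev pev0.
rewrite oppr_eq0 => /eqP g0.
by move: e; rewrite g0 mul0r addr0 => ->; rewrite elt_pev pev0.
Qed.

Lemma normM f g f' g' :
  qnorm (qmul_re f g f' g') (qmul_im f g f' g') = qnorm f g * qnorm f' g'.
Proof. by rewrite /qnorm /qmul_re /qmul_im; ring. Qed.

(** Integrality of x: if x had a pole, then x^2 = T x - N would have order greater than 2 ord x. *)
Lemma vge_x P : vge P 0 y -> vge P 0 x.
Proof.
move=> hy; apply/vgeP => x0; rewrite leNgt; apply/negP => hx.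
have : vge P (ord P x + ord P x + 1) (x ^+ 2).
  rewrite (quad_eq QE); apply: vgeB.
    apply: vge_trans (vgeM (vge_pev T hy) (vge_ordE P x)); lia.
  apply: vge_trans (vge_pev N hy); lia.
rewrite vge_ord ?expf_neq0 // ordX mulr2n; lia.
Qed.

Lemma vge_elt P f g : vge P 0 y -> vge P 0 (qelt f g).
Proof.
move=> hy; apply: vgeD; first exact: vge_pev.
by rewrite -[0]addr0; apply: vgeM; [exact: vge_pev|exact: vge_x].
Qed.

(* J cuts out, on coordinates, a maximal ideal of K[y] + K[y] x lying over p,  *)
(* t generates it locally, and p = t^e up to a local unit.                     *)
Record local_center p (J : {poly K} -> {poly K} -> bool) (t : F) (e n : nat) : Prop := Center {
  center_D : forall f g f' g', J f g -> J f' g' -> J (f + f') (g + g');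
  center_M : forall f g f' g', J f' g' -> J (qmul_re f g f' g') (qmul_im f g f' g');
  center_prime : forall f g f' g', ~~ J f g -> ~~ J f' g' ->
    ~~ J (qmul_re f g f' g') (qmul_im f g f' g');
  center_p : forall f, J f 0 = (p %| f);
  center_t : exists f g, t = qelt f g /\ J f g;
  center_unif : forall f g, J f g -> exists f1 g1 f2 g2,
    ~~ J f1 g1 /\ qelt f1 g1 * qelt f g = t * qelt f2 g2;
  center_pfact : exists f1 g1 f2 g2,
    [/\ ~~ J f1 g1, ~~ J f2 g2 & pev p * qelt f1 g1 = t ^+ e * qelt f2 g2];
  center_inv : forall f g, ~~ J f g -> exists f' g',
    J (qmul_re f g f' g' - 1) (qmul_im f g f' g');
  center_basis : exists u v : 'I_n -> {poly K},
    (forall c : 'I_n -> K, J (\sum_i c i *: u i) (\sum_i c i *: v i) -> forall i, c i = 0) /\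
    (forall f g, exists c : 'I_n -> K, J (f - \sum_i c i *: u i) (g - \sum_i c i *: v i))
}.

(** * The discrete valuation ring at a prime of K[y] + K[y] x *)

Section CenterPlace.
Variables (p : {poly K}) (J : {poly K} -> {poly K} -> bool) (t : F) (e n : nat).
Hypotheses (irp : irreducible_poly p) (C : local_center p J t e n).

Let R : set F := [set z | exists f g, z = qelt f g].
Let I : set F := [set z | exists f g, z = qelt f g /\ J f g].

Let I_elt f g : I (qelt f g) <-> J f g.
Proof. by split=> [[f' [g' [/elt_inj[-> ->]]]]|h] //; exists f, g. Qed.

Let notI_elt f g : ~~ J f g -> ~ I (qelt f g).
Proof. by move/negP => h /I_elt. Qed.

Let R_elt f g : R (qelt f g).
Proof. by exists f, g. Qed.

Let notI_pev f : ~~ (p %| f) -> ~ I (pev f).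
Proof. by rewrite -elt_pev -(center_p C) => /notI_elt. Qed.

Let I0 : I 0.
Proof. by rewrite -(pev0 iota y) -elt_pev; apply/I_elt; rewrite (center_p C) dvdp0. Qed.

Let I_M a b : R a -> I b -> I (a * b).
Proof.
move=> [f [g ->]] [f' [g' [-> h]]]; rewrite eltM; apply/I_elt.
exact: (center_M C).
Qed.

Let prime_I a b : R a -> R b -> ~ I a -> ~ I b -> ~ I (a * b).
Proof.
move=> [f [g ->]] [f' [g' ->]]; rewrite eltM !I_elt.
by move=> /negP h1 /negP h2; apply/negP/(center_prime C).
Qed.

Let R_M a b : R a -> R b -> R (a * b).
Proof. by move=> [f [g ->]] [f' [g' ->]]; rewrite eltM. Qed.

Let unit_pow m a : R a -> ~ I a -> R (a ^+ m) /\ ~ I (a ^+ m).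
Proof.
have h1 : ~~ (p %| 1) by rewrite dvdp1 gtn_eqF // irp.1.
move=> Ra ha; elim: m => [|m [IH1 IH2]].
  by rewrite expr0 -(pev1 iota y); split; [rewrite -elt_pev|apply: notI_pev].
by rewrite exprS; split; [apply: R_M|apply: prime_I].
Qed.

Let pev_fact f : f != 0 -> exists m a b, [/\ R a, ~ I a, R b, ~ I b & pev f * b = t ^+ m * a].
Proof.
move=> /(poly_primary_part irp.1)[k [g [-> hg]]].
have [f1 [g1 [f2 [g2 [h1 h2 E]]]]] := center_pfact C.
have [Rb hb] := unit_pow k (R_elt f1 g1) (notI_elt h1).
have [Ra ha] := unit_pow k (R_elt f2 g2) (notI_elt h2).
have Rg : R (pev g) by rewrite -elt_pev.
exists (e * k)%N, (qelt f2 g2 ^+ k * pev g), (qelt f1 g1 ^+ k); split => //.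
- exact: R_M.
- by apply: prime_I => //; apply: notI_pev.
- by rewrite pevM pevX mulrAC -exprMn E exprMn exprM mulrA.
Qed.

Let t_neq0 : t != 0.
Proof.
have /(center_unif C)[f1 [g1 [f2 [g2 [h E]]]]] : J p 0 by rewrite (center_p C).
apply: contraTneq isT => t0; exfalso; move: E; rewrite t0 mul0r elt_pev => /eqP.
rewrite mulf_eq0 pev_eq0 (negPf (irredp_neq0 irp)) orbF => /eqP E.
by apply: (notI_elt h); rewrite E.
Qed.

(* Dividing by t lowers the order of r * conj r, which is a norm. *)
Let factI m : forall r, R r ->
  (exists s a b, [/\ R s, R a /\ ~ I a, R b & ~ I b /\ r * s * b = t ^+ m * a]) ->
  exists (k : nat) a b, [/\ R a, ~ I a, R b, ~ I b & r * b = t ^+ k * a].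
Proof.
have R1 : R 1 by rewrite -(pev1 iota y) -elt_pev.
have hI1 : ~ I 1.
  by rewrite -(pev1 iota y); apply: notI_pev; rewrite dvdp1 gtn_eqF // irp.1.
elim: m => [|m IH] r Rr [s [a [b [Rs [Ra ha] Rb [hb E]]]]].
  exists 0%N, r, 1; split => //; last by rewrite mulr1 mul1r.
  by move=> Ir; apply: ha; rewrite -[a]mul1r -(expr0 t) -E -mulrA mulrC; apply: I_M => //; apply: R_M.
have [Ir|hr] := pselect (I r); last by exists 0%N, r, 1; rewrite mulr1 mul1r.
case: (Ir) => f [g [rE /(center_unif C)[f1 [g1 [f2 [g2 [h1 E1]]]]]]].
have [] := IH (qelt f2 g2) (R_elt _ _).
  exists s, (qelt f1 g1 * a), b; split => //.
    by split; [apply: R_M|apply: prime_I => //; apply: notI_elt].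
  split => //; apply: (mulfI t_neq0).
  transitivity (qelt f1 g1 * (r * s * b)); first by rewrite rE !mulrA E1.
  by rewrite E exprS; ring.
move=> k [a' [b' [Ra' ha' Rb' hb' E']]].
exists k.+1, a', (qelt f1 g1 * b'); split => //; [exact: R_M| |].
  by apply: prime_I => //; apply: notI_elt.
transitivity (t * (qelt f2 g2 * b')); last by rewrite E' exprS mulrA.
by rewrite [RHS]mulrA -E1 -rE; ring.
Qed.

Lemma center_dvr : dvr_data iota R I t.
Proof.
have [t1 [t2 [tE Jt]]] := center_t C.
split.
- by move=> c; rewrite -(pevC iota y) -elt_pev.
- by move=> a b [f [g ->]] [f' [g' ->]]; rewrite eltD.
- exact: R_M.
- by move=> z [f [g [-> _]]].
- move=> a b [f [g [-> h]]] [f' [g' [-> h']]]; rewrite eltD; apply/I_elt.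
  exact: (center_D C).
- exact: I_M.
- exact: prime_I.
- by rewrite -(pev1 iota y); apply: notI_pev; rewrite dvdp1 gtn_eqF // irp.1.
- by rewrite tE; apply/I_elt.
- exact: t_neq0.
- move=> r Rr r0; case: (Rr) => f [g rE].
  have : qnorm f g != 0 by apply: norm_neq0; rewrite -rE.
  move=> /pev_fact[m [a [b [Ra ha Rb hb E]]]]; apply: (factI (m := m)) => //.
  by exists (qelt (f + g * T) (- g)), a, b; split => //; split => //; rewrite rE elt_norm.
- move=> z; have [f [g [d [d0 ->]]]] := quad_gen QE z.
  by exists (qelt f g), (pev d); split => //; rewrite ?pev_eq0 // -elt_pev.
Qed.

(** The place of the localization at J. The last clause says that it is the only place centred at J,
    which later shows that a list of places above p is complete. *)
Lemma center_place : exists P, [/\ ord P (pev p) = e,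
    (forall f g, J f g = vge P 1 (qelt f g)),
    ord P t = 1,
    isdim iota (valuation_ring P) (maximal_ideal P) n &
    forall P', (forall f g, J f g -> vge P' 1 (qelt f g)) ->
      (forall f g, ~~ J f g -> ord P' (qelt f g) = 0) -> P' = P].
Proof.
have D := center_dvr; exists (dvr_place D).
have JE f g : J f g = vge (dvr_place D) 1 (qelt f g).
  by apply/idP/idP => [/I_elt/(vge_dvr_I D (R_elt f g))|/(vge_dvr_I D (R_elt f g))/I_elt].
split => //.
- have [f1 [g1 [f2 [g2 [h1 h2 E]]]]] := center_pfact C.
  have u1 := notI_elt h1; have u2 := notI_elt h2.
  have := congr1 (ord (dvr_place D)) E.
  have e1 : ord (dvr_place D) (qelt f1 g1) = 0 by apply: ord_dvr_notI.
  have e2 : ord (dvr_place D) (qelt f2 g2) = 0 by apply: ord_dvr_notI.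
  rewrite !ordM ?expf_neq0 ?pev_eq0 ?(irredp_neq0 irp) ?(dvr_notI_neq0 D u1) ?(dvr_notI_neq0 D u2) //.
  by rewrite e1 e2 !addr0 ordX ord_dvr_t natz.
- exact: ord_dvr_t.
- have [u [v [ind span]]] := center_basis C.
  have combE c : comb iota c (fun i => qelt (u i) (v i)) =
      qelt (\sum_i c i *: u i) (\sum_i c i *: v i).
    rewrite /qelt !pev_sum mulr_suml -big_split /=; apply: eq_bigr => i _.
    by rewrite !pevZ; ring.
  apply: (dvr_residue_dim D (e := fun i => qelt (u i) (v i))) => //.
  + by move=> c; rewrite combE => /I_elt; apply: ind.
  + move=> r [f [g ->]]; have [c hc] := span f g; exists c.
    by rewrite combE eltB; apply/I_elt.
  + move=> b [f [g ->]] hb; have hJ : ~~ J f g by apply/negP => /I_elt.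
    have [f' [g' h]] := center_inv C hJ; exists (qelt f' g'); split => //.
    by rewrite eltM -(pev1 iota y) -elt_pev eltB subr0; apply/I_elt.
- move=> P' h1 h2; apply: (dvr_place_unique D).
    by move=> a [f [g ->]] ha; apply: h2; apply/negP => /I_elt.
  have [t1 [t2 [tE Jt]]] := center_t C.
  by have := h1 _ _ Jt; rewrite -tE vge_ord ?t_neq0.
Qed.

End CenterPlace.

End QuadraticExtension.

(** * Places above an irreducible polynomial *)

Section PolyResidues.
Variable K : fieldType.
Implicit Types (p f : {poly K}).

Lemma sum_monomialsE n (c : 'I_n -> K) :
  exists q : {poly K}, [/\ \sum_(i < n) c i *: 'X^i = q, (size q <= n)%N &
    forall i : 'I_n, q`_i = c i].
Proof.
exists (\sum_(i < n) c i *: 'X^i); split => //.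
  apply: (leq_trans (size_sum _ _ _)); apply/bigmax_leqP => i _.
  by apply: leq_trans (size_scale_leq _ _) _; rewrite size_polyXn.
move=> i; rewrite coef_sum (bigD1 i) //= coefZ coefXn eqxx mulr1 big1 ?addr0 // => j ji.
by rewrite coefZ coefXn (inj_eq val_inj) eq_sym (negPf ji) mulr0.
Qed.

Lemma monomials_indep p (c : 'I_(size p).-1 -> K) : (1 < size p)%N ->
  p %| \sum_i c i *: 'X^i -> forall i, c i = 0.
Proof.
move=> sp; have [q [-> sq qc]] := sum_monomialsE c.
have [q0 _ i|q0 /(dvdp_leq q0) pq] := eqVneq q 0; first by rewrite -qc q0 coef0.
by exfalso; move: sp sq pq; clear; move: (size p) (size q) => a b; lia.
Qed.

Lemma monomials_span p f : (1 < size p)%N ->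
  exists c : 'I_(size p).-1 -> K, p %| f - \sum_i c i *: 'X^i.
Proof.
move=> sp; have p0 : p != 0 by apply: contraTneq sp => ->; rewrite size_poly0.
exists (fun i => (f %% p)`_i).
rewrite -(poly_def _ (fun i => (f %% p)`_i)).
have -> : \poly_(i < (size p).-1) (f %% p)`_i = f %% p.
  apply/polyP => i; rewrite coef_poly; case: ltnP => // hi.
  rewrite nth_default //; apply: leq_trans hi.
  have : (size (f %% p)%R < size p)%N by rewrite ltn_modp.
  by move: sp; clear; move: (size p) (size (f %% p)%R) => a b; lia.
by rewrite {1}(divp_eq f p) addrK dvdp_mull.
Qed.

Lemma irreducible_dvdM p f g : irreducible_poly p -> (p %| f * g) = (p %| f) || (p %| g).
Proof.
move=> irp; apply/idP/orP => [h|[h|h]]; [|exact: dvdp_mulr|exact: dvdp_mull].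
have [|hf] := boolP (p %| f); [by left|right].
by rewrite -(@Gauss_dvdpr _ g f p) // irreducible_poly_coprime.
Qed.

Lemma irreducible_inverse p f : irreducible_poly p -> ~~ (p %| f) ->
  exists u, p %| u * f - 1.
Proof.
move=> irp hf.
have /Bezout_eq1_coprimepP[[u v] /= e] : coprimep p f by rewrite irreducible_poly_coprime.
by exists v; rewrite -e opprD addrCA subrr addr0 -mulNr dvdp_mull.
Qed.

Lemma dvdp_comb p f g u v h : p %| f -> p %| g -> h = u * f + v * g -> p %| h.
Proof. by move=> hf hg ->; rewrite dvdp_add // dvdp_mull. Qed.

Lemma dvdp_subE p f g : p %| f - g -> (p %| f) = (p %| g).
Proof. by move=> h; rewrite -[f](subrK g) dvdp_addr. Qed.

End PolyResidues.

Section QuadraticPlaces.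
Variables (K F : fieldType) (iota : {rmorphism K -> F}).
Variables (x y : F) (T N : {poly K}).
Hypothesis QE : quadratic_ext iota x y T N.
Implicit Types (f g h p : {poly K}) (P : place iota).

Local Notation pev := (pval iota y).
Local Notation elt := (qelt iota x y).
Local Notation norm := (qnorm T N).
Local Notation mul_re := (qmul_re N).
Local Notation mul_im := (qmul_im T).
Local Notation charpoly_at := (charpoly_value T N).
Local Notation center := (local_center iota x y T N).

Variable p : {poly K}.
Hypothesis irp : irreducible_poly p.

Let sp : (1 < size p)%N := irp.1.

Section Inert.
Hypothesis noroot : forall h, ~~ (p %| charpoly_at h).

Let J f g := (p %| f) && (p %| g).

(** If p divides the norm but not g, and u inverts g modulo p, then - f u is a root of the
    characteristic polynomial modulo p, against [noroot]. So p divides g, and then f^2. *)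
Lemma inert_norm f g : (p %| norm f g) = J f g.
Proof.
apply/idP/andP => [h|[hf hg]]; last first.
  by apply: (dvdp_comb (u := f) (v := f * T + g * N) hf hg); rewrite /qnorm; ring.
have hg : p %| g.
  apply: contrapT => /negP hg; have [u hu] := irreducible_inverse irp hg.
  have /negP := noroot (- f * u); apply.
  apply: (dvdp_comb (u := u ^+ 2) (v := - (f * u * T + (u * g + 1) * N)) h hu).
  by rewrite /charpoly_value /qnorm; ring.
split => //; rewrite -[p %| f]orbb -irreducible_dvdM //.
by apply: (dvdp_comb (u := 1) (v := - (f * T + g * N)) h hg); rewrite /qnorm; ring.
Qed.

Lemma inert_center : center p J (pev p) 1 ((size p).-1 + (size p).-1).
Proof.
have ndvd1 : ~~ (p %| 1) by rewrite dvdp1 gtn_eqF.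
split.
- by move=> f g f' g' /andP[h1 h2] /andP[h3 h4]; rewrite /J !dvdp_add.
- move=> f g f' g' /andP[h1 h2]; apply/andP; split.
    by apply: (dvdp_comb (u := f) (v := - g * N) h1 h2); rewrite /qmul_re; ring.
  by apply: (dvdp_comb (u := g) (v := f + g * T) h1 h2); rewrite /qmul_im; ring.
- by move=> f g f' g'; rewrite -!inert_norm normM irreducible_dvdM // negb_or => -> ->.
- by move=> f; rewrite /J dvdp0 andbT.
- by exists p, 0; rewrite elt_pev /J dvdpp dvdp0.
- move=> f g /andP[/dvdpP[k ->] /dvdpP[l ->]]; exists 1, 0, k, l.
  split; first by rewrite /J (negPf ndvd1).
  by rewrite elt_pev pev1 /qelt !pevE; ring.
- exists 1, 0, 1, 0; rewrite /J (negPf ndvd1); split => //.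
- move=> f g; rewrite -inert_norm => /(irreducible_inverse irp)[u hu].
  exists ((f + g * T) * u), (- g * u); apply/andP; split.
    by apply: (dvdp_comb (u := 1) (v := 0) hu hu); rewrite /qnorm /qmul_re; ring.
  by rewrite (_ : mul_im _ _ _ _ = 0) ?dvdp0 // /qmul_im; ring.
- pose d := (size p).-1.
  (* The residue field has the basis y^i, y^i x for i < deg p, hence degree 2 deg p. *)
  exists (fun i => match fintype.split i with inl j => 'X^j | inr _ => 0 end),
         (fun i => match fintype.split i with inl _ => 0 | inr j => 'X^j end).
  have sumE (c : 'I_(d + d) -> K) : 
    (\sum_i c i *: (match fintype.split i with inl j => 'X^j | inr _ => 0 end) : {poly K}) =
      \sum_(i < d) c (lshift d i) *: 'X^i /\
    (\sum_i c i *: (match fintype.split i with inl _ => 0 | inr j => 'X^j end) : {poly K}) =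
      \sum_(i < d) c (rshift d i) *: 'X^i.
    split; rewrite big_split_ord /=.
      rewrite [X in _ + X]big1 ?addr0 => [|i _]; last by rewrite (unsplitK (inr i)) scaler0.
      by apply: eq_bigr => i _; rewrite (unsplitK (inl i)).
    rewrite big1 ?add0r => [|i _]; last by rewrite (unsplitK (inl i)) scaler0.
    by apply: eq_bigr => i _; rewrite (unsplitK (inr i)).
  split.
    move=> c; have [-> ->] := sumE c.
    move=> /andP[/(monomials_indep sp) h1 /(monomials_indep sp) h2] i.
    case: (splitP i) => j ij.
      by rewrite (_ : i = lshift d j) ?h1 //; apply: val_inj.
    by rewrite (_ : i = rshift d j) ?h2 //; apply: val_inj.
  move=> f g; have [c1 h1] := monomials_span f sp; have [c2 h2] := monomials_span g sp.
  exists (fun i => match fintype.split i with inl j => c1 j | inr j => c2 j end).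
  have [-> ->] := sumE (fun i => match fintype.split i with inl j => c1 j | inr j => c2 j end).
  apply/andP; split.
    by under eq_bigr do rewrite (unsplitK (inl _)).
  by under eq_bigr do rewrite (unsplitK (inr _)).
Qed.

(** Outside J the norm has order 0 at P; it is the product of two conjugates of nonnegative order,
    so each has order 0. *)
Lemma inert_unique P : 0 < ord P (pev p) ->
  (forall f g, J f g -> vge P 1 (elt f g)) /\
  (forall f g, ~~ J f g -> ord P (elt f g) = 0).
Proof.
move=> hp; have hy := vge_of_pev sp hp.
have p1 : vge P 1 (pev p) by apply/vgeP.
split=> f g.
  move=> /andP[/dvdpP[k ->] /dvdpP[l ->]].
  have -> : elt (k * p) (l * p) = elt k l * pev p by rewrite /qelt !pevE; ring.
  by rewrite -[1]add0r; apply: vgeM => //; apply: (vge_elt QE).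
rewrite -inert_norm => /(ord_pev_coprime irp hp)[n0 e].
have := elt_norm QE f g => E; move: n0 e; rewrite -E mulf_eq0 negb_or => /andP[e0 e0'].
rewrite ordM //.
have := vge_elt QE f g hy; have := vge_elt QE (f + g * T) (- g) hy.
rewrite !vge_ord //; lia.
Qed.

End Inert.

Section Root.
Variable h : {poly K}.
Hypothesis hroot : p %| charpoly_at h.

(** The ideal (p, x - h): the kernel of the evaluation x := h modulo p. *)
Definition root_ideal f g := p %| f + g * h.
Local Notation J := root_ideal.

(** The evaluation x := h is multiplicative modulo p because h is a root there. *)
Lemma root_mul f g f' g' :
  p %| mul_re f g f' g' + mul_im f g f' g' * h - (f + g * h) * (f' + g' * h).
Proof.
apply: (dvdp_comb (u := - (g * g')) (v := 0) hroot hroot).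
by rewrite /qmul_re /qmul_im /charpoly_value; ring.
Qed.

Lemma root_center t e : (exists f g, t = elt f g /\ J f g) ->
  (forall f g, J f g -> exists f1 g1 f2 g2,
    ~~ J f1 g1 /\ elt f1 g1 * elt f g = t * elt f2 g2) ->
  (exists f1 g1 f2 g2,
    [/\ ~~ J f1 g1, ~~ J f2 g2 & pev p * elt f1 g1 = t ^+ e * elt f2 g2]) ->
  center p J t e (size p).-1.
Proof.
have JM f g f' g' : J (mul_re f g f' g') (mul_im f g f' g') = J f g || J f' g'.
  by rewrite /J (dvdp_subE (root_mul _ _ _ _)) irreducible_dvdM.
move=> ht hunif hp; split => //.
- move=> f g f' g' h1 h2; apply: (dvdp_comb (u := 1) (v := 1) h1 h2); ring.
- by move=> f g f' g' h'; rewrite JM h' orbT.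
- by move=> f g f' g' h1 h2; rewrite JM negb_or h1.
- by move=> f; rewrite /J mul0r addr0.
- move=> f g /(irreducible_inverse irp)[u hu]; exists u, 0.
  by apply: (dvdp_comb (u := 1) (v := 0) hu hu); rewrite /qmul_re /qmul_im; ring.
- exists (fun i => 'X^i), (fun=> 0); split.
    move=> c; rewrite [X in J _ X]big1 => [|i _]; last by rewrite scaler0.
    by rewrite /J mul0r addr0; apply: monomials_indep.
  move=> f g; have [c hc] := monomials_span (f + g * h) sp; exists c.
  rewrite [X in J _ (_ - X)]big1 => [|i _]; last by rewrite scaler0.
  by rewrite /J subr0 addrAC.
Qed.

(** With [elt (- h) 1] equal to x - h, write f + g x = (f + g h) + g (x - h); the second term
    vanishes at P, so the polynomial f + g h decides. *)
Lemma root_unique P : 0 < ord P (pev p) -> vge P 1 (elt (- h) 1) ->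
  (forall f g, J f g -> vge P 1 (elt f g)) /\
  (forall f g, ~~ J f g -> ord P (elt f g) = 0).
Proof.
move=> hp hx; have hy := vge_of_pev sp hp.
have p1 : vge P 1 (pev p) by apply/vgeP.
have E f g : elt f g = pev (f + g * h) + pev g * elt (- h) 1.
  by rewrite /qelt !pevE; ring.
have hg g : vge P 1 (pev g * elt (- h) 1).
  by rewrite -[1]add0r; apply: vgeM => //; apply: vge_pev.
split=> f g hJ; rewrite E.
  apply: vgeD => //; case/dvdpP: hJ => k ->; rewrite pevM -[1]add0r.
  by apply: vgeM => //; apply: vge_pev.
have [e0 e1] := ord_pev_coprime irp hp hJ.
by have [] := @ordD_eq _ _ _ P _ (pev g * elt (- h) 1) e0; rewrite e1.
Qed.

End Root.
End QuadraticPlaces.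

Lemma subspace_vge (K F : fieldType) (iota : {rmorphism K -> F}) (P : place iota) n :
  subspace iota [set z | vge P n z].
Proof. by split=> [|u v|c u] /=; [exact: vge0|exact: vgeD|exact: vgeZ]. Qed.

Lemma subspace_maximal_ideal (K F : fieldType) (iota : {rmorphism K -> F}) (P : place iota) :
  subspace iota (maximal_ideal P).
Proof.
have -> : maximal_ideal P = [set z | vge P 1 z].
  by apply/funext => z; apply/propext; apply: maximal_idealE.
exact: subspace_vge.
Qed.

Lemma place_degreeE (K F : fieldType) (iota : {rmorphism K -> F}) (P : place iota) n :
  isdim iota (valuation_ring P) (maximal_ideal P) n -> place_degree P = n.
Proof. by apply: quotient_dimE; apply: subspace_maximal_ideal. Qed.

(** * Decomposition of p: inert, split and ramified *)

Section PlacesOver.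
Variables (K F : fieldType) (iota : {rmorphism K -> F}).
Variables (x y : F) (T N : {poly K}).
Hypothesis QE : quadratic_ext iota x y T N.
Implicit Types (f g h p : {poly K}) (P : place iota).

Local Notation pev := (pval iota y).
Local Notation elt := (qelt iota x y).
Local Notation charpoly_at := (charpoly_value T N).

Variable p : {poly K}.
Hypothesis irp : irreducible_poly p.

Let sp : (1 < size p)%N := irp.1.

(** S is the complete list of places above p. The fourth clause is the equality sum of e f = 2,
    multiplied by deg p; the last one says that K[y] + K[y] x is integrally closed locally at p. *)
Definition places_over (S : seq (place iota)) : Prop :=
  [/\ uniq S,
      forall P, (P \in S) = (0 < ord P (pev p)),
      forall P, P \in S -> exists n, isdim iota (valuation_ring P) (maximal_ideal P) n,
      \sum_(P <- S) ord P (pev p) * (place_degree P)%:Z = ((size p).-1 * 2)%:Z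
    & forall f g, (forall P, P \in S -> vge P (ord P (pev p)) (elt f g)) ->
        p %| f /\ p %| g].

Lemma places_over_inert : (forall h, ~~ (p %| charpoly_at h)) -> exists S, places_over S.
Proof.
move=> noroot; have C := inert_center iota x y irp noroot.
have [P [P1 P2 P3 P4 P5]] := center_place QE irp C.
exists [:: P]; split => //.
- move=> Q; rewrite inE; apply/eqP/idP => [->|]; first by rewrite P1.
  by move/(inert_unique QE irp noroot) => [h1 h2]; apply: P5.
- by move=> Q; rewrite inE => /eqP ->; exists ((size p).-1 + (size p).-1)%N.
- by rewrite big_seq1 P1 (place_degreeE P4) mul1r muln2 addnn.
- move=> f g /(_ P); rewrite inE eqxx P1 => /(_ isT).
  by rewrite -P2 => /andP[].
Qed.

Lemma root_factor h : elt (- h) 1 * elt (h - T) 1 = - pev (charpoly_at h).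
Proof.
rewrite (eltM QE) /charpoly_value -pevN -(elt_pev iota x) /qmul_re /qmul_im; congr elt; ring.
Qed.

(* p divides (x - h)(x - (T - h)) and the second factor is a local unit, so p   *)
(* generates the ideal locally.                                                *)
Lemma split_center h : p %| charpoly_at h -> ~~ (p %| h + h - T) ->
  local_center iota x y T N p (root_ideal p h) (pev p) 1 (size p).-1.
Proof.
move=> hroot hsep; have ndvd1 : ~~ (p %| 1) by rewrite dvdp1 gtn_eqF.
apply: root_center => //.
- by exists p, 0; rewrite elt_pev /root_ideal mul0r addr0.
- move=> f g /dvdpP[k fE]; case/dvdpP: (hroot) => c cE.
  have := root_factor h; rewrite cE => E.
  exists (h - T), 1, (k * (h - T) - g * c), k; split.
    by rewrite /root_ideal mul1r (_ : h - T + h = h + h - T) //; ring.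
  have -> : elt f g = pev (k * p) + pev g * elt (- h) 1.
    by rewrite -fE /qelt !pevE; ring.
  transitivity (pev (k * p) * elt (h - T) 1 + pev g * (elt (- h) 1 * elt (h - T) 1)); first by ring.
  by rewrite E /qelt !pevE; ring.
- by exists 1, 0, 1, 0; rewrite /root_ideal mul0r addr0; split; rewrite // elt_pev pev1 expr1.
Qed.

Lemma split_place h : p %| charpoly_at h -> ~~ (p %| h + h - T) ->
  exists P, [/\ ord P (pev p) = 1,
    (forall f g, root_ideal p h f g = vge P 1 (elt f g)),
    isdim iota (valuation_ring P) (maximal_ideal P) (size p).-1 &
    forall Q, 0 < ord Q (pev p) -> vge Q 1 (elt (- h) 1) -> Q = P].
Proof.
move=> hroot hsep; have C := split_center hroot hsep.
have [P [P1 P2 P3 P4 P5]] := center_place QE irp C.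
exists P; split => // Q hQ hx; have [h1 h2] := root_unique irp hQ hx.
exact: P5.
Qed.

(** The product (x - h)(x - (T - h)) is divisible by p and so vanishes at P, while both factors are
    regular there; hence one of them vanishes. *)
Lemma place_over_root h P : p %| charpoly_at h -> 0 < ord P (pev p) ->
  vge P 1 (elt (- h) 1) \/ vge P 1 (elt (- (T - h)) 1).
Proof.
move=> /dvdpP[c cE] hp; have hy := vge_of_pev sp hp.
have p1 : vge P 1 (pev p) by apply/vgeP.
have := root_factor h; rewrite cE pevM opprB => E.
have := vge_elt QE (- h) 1 hy; have := vge_elt QE (h - T) 1 hy.
have [-> _ _|a0] := eqVneq (elt (- h) 1) 0; first by left; exact: vge0.
have [-> _ _|b0] := eqVneq (elt (h - T) 1) 0; first by right; exact: vge0.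
have : vge P 1 (elt (- h) 1 * elt (h - T) 1).
  by rewrite E; apply: vgeN; rewrite -[1]add0r; apply: vgeM => //; apply: vge_pev.
rewrite !vge_ord ?mulf_neq0 // ordM // => h1 h2 h3.
have [?|h4] := leP 1 (ord P (elt (- h) 1)); [by left|right].
move: h1 h2 h3 h4; clear.
move: (ord P (elt (- h) 1)) (ord P (elt (h - T) 1)) => a b; lia.
Qed.

(** The conjugate roots h and T - h differ modulo p, and each gives an unramified place of degree
    deg p. An element f + g x vanishing at both satisfies p | g (2 h - T), so p divides g and then
    f. *)
Lemma places_over_split h : p %| charpoly_at h -> ~~ (p %| h + h - T) ->
  exists S, places_over S.
Proof.
move=> hroot hsep; pose h' := T - h.
have hroot' : p %| charpoly_at h' by rewrite (_ : charpoly_at h' = charpoly_at h) // /charpoly_value /h'; ring.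
have hsep' : ~~ (p %| h' + h' - T).
  by rewrite -dvdpNr (_ : - (h' + h' - T) = h + h - T) // /h'; ring.
have [P [P1 P2 P3 P4]] := split_place hroot hsep.
have [Q [Q1 Q2 Q3 Q4]] := split_place hroot' hsep'.
have PQ : P != Q.
  apply/negP => /eqP PQ; move/negP: hsep; apply.
  have : root_ideal p h (- h') 1 by rewrite P2 PQ -Q2 /root_ideal mul1r addNr dvdp0.
  by rewrite /root_ideal mul1r (_ : - h' + h = h + h - T) // /h'; ring.
have PS : \sum_(R <- [:: P; Q]) ord R (pev p) * (place_degree R)%:Z = ((size p).-1 * 2)%:Z.
  rewrite big_cons big_seq1 P1 Q1 (place_degreeE P3) (place_degreeE Q3) !mul1r.
  by rewrite -PoszD addnn muln2.
exists [:: P; Q]; split => //.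
- by rewrite /= inE PQ.
- move=> R; rewrite !inE; apply/orP/idP => [[/eqP->|/eqP->]|hR]; rewrite ?P1 ?Q1 //.
  have [hx|hx] := place_over_root hroot hR.
    by left; rewrite (P4 R).
  by right; rewrite (Q4 R).
- by move=> R; rewrite !inE => /orP[/eqP->|/eqP->]; exists (size p).-1.
- move=> f g hfg; have := hfg P; have := hfg Q; rewrite !inE !eqxx orbT P1 Q1 -P2 -Q2 /root_ideal.
  move=> /(_ isT) hQ /(_ isT) hP.
  have hg : p %| g.
    have : p %| g * (h + h - T).
      by apply: (dvdp_comb (u := 1) (v := -1) hP hQ); rewrite /h'; ring.
    by rewrite irreducible_dvdM // (negPf hsep) orbF.
  by split=> //; apply: (dvdp_comb (u := 1) (v := - h) hP hg); ring.
Qed.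

(* With 2 h - T = l p, the identity (x - h)^2 = - p (c + l (x - h)) shows that  *)
(* x - h is a uniformizer and that p has order 2.                              *)
Lemma places_over_ramified h : p %| charpoly_at h -> p %| h + h - T ->
  ~~ (p ^+ 2 %| charpoly_at h) -> exists S, places_over S.
Proof.
move=> hroot /dvdpP[l lE] hsm; have ndvd1 : ~~ (p %| 1) by rewrite dvdp1 gtn_eqF.
case/dvdpP: (hroot) => c cE; have p0 := irredp_neq0 irp.
have hc : ~~ (p %| c) by apply: contra hsm; rewrite cE expr2 dvdp_mul2r.
pose t := elt (- h) 1; pose b := elt (c - l * h) l.
have hb : ~~ root_ideal p h (c - l * h) l by rewrite /root_ideal subrK.
have bt : pev p * b = - t ^+ 2.
  have E : - pev (charpoly_at h) = t * (t + pev (h + h - T)).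
    by rewrite -root_factor /t; congr (_ * _); rewrite /qelt !pevE; ring.
  apply/eqP; rewrite -[- t ^+ 2](addrK (pev (h + h - T) * t)); apply/eqP.
  have -> : - t ^+ 2 + pev (h + h - T) * t = pev (charpoly_at h) + (pev (h + h - T) * t) *+ 2.
    by rewrite -[pev (charpoly_at h)]opprK E; ring.
  rewrite lE cE /b /t /qelt !pevE; ring.
have C : local_center iota x y T N p (root_ideal p h) t 2 (size p).-1.
  apply: root_center => //.
  - by exists (- h), 1; rewrite /root_ideal mul1r addNr dvdp0.
  - move=> f g /dvdpP[k fE]; exists (c - l * h), l.
    have E : elt f g = pev k * pev p + pev g * t.
      by rewrite -pevM -fE /t /qelt !pevE; ring.
    exists (k * h + g * (c - l * h)), (- k + g * l); split => //.
    rewrite -/b E.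
    transitivity (pev k * (pev p * b) + pev g * b * t); first by ring.
    by rewrite bt /b /t /qelt !pevE; ring.
  - exists (c - l * h), l, (-1), 0; split => //.
      by rewrite /root_ideal mul0r addr0 dvdpNr.
    by rewrite -/b bt elt_pev pevN pev1 mulrN1.
have [P [P1 P2 P3 P4 P5]] := center_place QE irp C.
exists [:: P]; split => //.
- move=> Q; rewrite inE; apply/eqP/idP => [->|hQ]; first by rewrite P1.
  have hx : vge Q 1 (elt (- h) 1).
    have [//|hx] := place_over_root hroot hQ.
    have -> : elt (- h) 1 = elt (- (T - h)) 1 - pev l * pev p.
      by rewrite -pevM -lE /qelt !pevE; ring.
    apply: vgeB => //; rewrite -[1]add0r; apply: vgeM; last by apply/vgeP.
    exact: vge_pev (vge_of_pev sp hQ).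
  by have [h1 h2] := root_unique irp hQ hx; apply: P5.
- by move=> Q; rewrite inE => /eqP ->; exists (size p).-1.
- by rewrite big_seq1 P1 (place_degreeE P4) mulnC.
- move=> f g /(_ P); rewrite inE eqxx P1 => /(_ isT) h2.
  have hy : vge P 0 y by apply: (vge_of_pev (iota := iota) (p := p)); rewrite ?P1.
  have : root_ideal p h f g by rewrite P2; apply: vge_trans h2.
  move=> fg; case/dvdpP: (fg) => k fE.
  have E : elt f g = pev k * pev p + pev g * t.
    by rewrite -pevM -fE /t /qelt !pevE; ring.
  have hg : p %| g.
    have : root_ideal p h g 0; last by rewrite /root_ideal mul0r addr0.
    have t0 : t != 0 by apply/negP => /eqP t0; move: P3; rewrite t0 /ord place0.
    rewrite P2 elt_pev -[1]/(2%:Z - 1) -(vgeMl 2 _ t0 P3).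
    rewrite mulrC (_ : pev g * t = elt f g - pev k * pev p); last by rewrite E; ring.
    apply: vgeB => //; apply: (@vge_trans _ _ _ _ (0 + 2)) => //; apply: vgeM; first exact: vge_pev.
    by apply/vgeP => _; rewrite P1.
  by split=> //; apply: (dvdp_comb (u := 1) (v := - h) fg hg); ring.
Qed.

(** The hypothesis is regularity of K[y] + K[y] x above p: at a double root modulo p the value is
    not divisible by p^2. The cases are no root, a simple root, a double root; arguing with roots
    instead of the discriminant covers characteristic 2 as well. *)
Theorem exists_places_over :
  (forall h, p %| charpoly_at h -> p %| h + h - T -> ~~ (p ^+ 2 %| charpoly_at h)) ->
  exists S, places_over S.
Proof.
move=> hsm; have [noroot|] := pselect (forall h, ~~ (p %| charpoly_at h)).
  exact: places_over_inert.
move=> /existsNP[h /negP]; rewrite negbK => hroot.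
have [hr|hr] := boolP (p %| h + h - T); last exact: places_over_split hr.
exact: places_over_ramified (hsm h hroot hr).
Qed.

End PlacesOver.

Lemma irreducible_factor (K : fieldType) (d : {poly K}) : (1 < size d)%N ->
  exists p, irreducible_poly p /\ p %| d.
Proof.
have [n] := ubnP (size d); elim: n d => // n IH d sd s1.
have [hd|] := pselect (irreducible_poly d); first by exists d.
move=> /not_andP[//|/existsNP[q /not_implyP[q1 /not_implyP[qd /negP nqd]]]].
have d0 : d != 0 by apply: contraTneq s1 => ->; rewrite size_poly0.
have q0 : q != 0 by apply: dvdpN0 qd d0.
have lt : (size q < size d)%N.
  rewrite ltn_neqAle dvdp_leq // andbT.
  by apply: contra nqd; rewrite (dvdp_size_eqp qd).
have [||p [irp pq]] := IH q.
- exact: leq_trans lt sd.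
- by rewrite ltn_neqAle eq_sym q1 size_poly_gt0.
- by exists p; split => //; apply: dvdp_trans qd.
Qed.

(** * Functions regular wherever y is regular *)

Section QuadraticIntegrality.
Variables (K F : fieldType) (iota : {rmorphism K -> F}).
Variables (x y : F) (T N : {poly K}).
Hypothesis QE : quadratic_ext iota x y T N.
Implicit Types (f g h p d : {poly K}) (P : place iota).

Local Notation pev := (pval iota y).
Local Notation elt := (qelt iota x y).

(** Otherwise all nonzero polynomials in y, in particular all nonzero norms, have order 0 at P. As
    conjugates are regular there, every nonzero element of F has order 0, against the surjectivity
    of the valuation. *)
Lemma place_over_irreducible P : vge P 0 y ->
  exists p, irreducible_poly p /\ 0 < ord P (pev p).
Proof.
move=> hy; apply: contrapT => /forallNP hP.
have hd d : d != 0 -> ord P (pev d) = 0.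
  have [n] := ubnP (size d); elim: n d => // n IH d sd d0.
  have [s1|] := leqP (size d) 1.
    by rewrite (size1_polyC s1) pevC ord_iota.
  move=> /irreducible_factor[p [irp /dvdpP[e dE]]].
  have e0 : e != 0 by apply: contraNneq d0 => e0; rewrite dE e0 mul0r.
  have p0 := irredp_neq0 irp.
  rewrite dE pevM ordM ?(pev_eq0 QE) // IH //; last first.
    have sp := irp.1; have se : (0 < size e)%N by rewrite size_poly_gt0.
    move: sd sp se; rewrite dE size_mul //; clear.
    by move: (size e) (size p) => a b; lia.
  have := vge_pev p hy; rewrite vge_ord ?(pev_eq0 QE) // add0r => h.
  have := hP p; apply: contra_notP => /eqP hn; split => //.
  by rewrite lt_neqAle eq_sym hn.
have he f g : elt f g != 0 -> ord P (elt f g) = 0.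
  move=> h0; have n0 := norm_neq0 QE h0; have := hd _ n0.
  have := pev_eq0 QE (qnorm T N f g); rewrite (negPf n0) => /negbT.
  rewrite -(elt_norm QE) mulf_eq0 negb_or => /andP[_ h1]; rewrite ordM //.
  have := vge_elt QE f g hy; have := vge_elt QE (f + g * T) (- g) hy.
  rewrite !vge_ord //; move: (ord P _) (ord P _) => a b; lia.
have [z z0] := ord_surj P; have [f [g [d [d0 zE]]]] := quad_gen QE z.
have h0 : elt f g != 0 by apply: contraNneq z0 => h; rewrite zE -/(elt f g) h mul0r.
by rewrite zE -/(elt f g) ordM ?invr_eq0 ?(pev_eq0 QE) // ordV hd // he.
Qed.

Lemma places_over_power p S k f g : irreducible_poly p -> places_over x y p S ->
  (forall P, P \in S -> vge P (ord P (pev p) *+ k) (elt f g)) ->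
  p ^+ k %| f /\ p ^+ k %| g.
Proof.
move=> irp [_ memS _ _ loc]; elim: k f g => [|k IH] f g h.
  by rewrite expr0 !dvd1p.
have p0 : pev p != 0 by rewrite (pev_eq0 QE) (irredp_neq0 irp).
have [|/dvdpP[f' fE] /dvdpP[g' gE]] := loc f g.
  move=> P PS; apply: vge_trans (h P PS); rewrite mulrS lerDl mulrn_wge0 //.
  by apply: ltW; rewrite -memS.
have E : elt f g = pev p * elt f' g' by rewrite fE gE /qelt !pevE; ring.
have [|hf hg] := IH f' g'; last by rewrite fE gE exprSr !dvdp_mul.
move=> P PS; have := h P PS; rewrite E (vgeMl _ _ p0 erefl) mulrS.
by rewrite addrAC subrr add0r.
Qed.

Hypothesis places : forall p, irreducible_poly p ->
  exists S : seq (place iota), places_over x y p S.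

(** Induction on the denominator: if p divides it, regularity of z above p forces p to divide both
    coordinates of the numerator, and p cancels. *)
Lemma integral_elt z : (forall P, vge P 0 y -> vge P 0 z) -> exists f g, z = elt f g.
Proof.
move=> hz; have [f [g [d [d0 zE]]]] := quad_gen QE z.
have [n] := ubnP (size d); elim: n d f g d0 zE => // n IH d f g d0 zE sd.
have [s1|] := leqP (size d) 1.
  have [c dE] : exists c, d = c%:P by exists d`_0; exact: size1_polyC.
  have c0 : c != 0 by rewrite -polyC_eq0 -dE.
  exists (c^-1 *: f), (c^-1 *: g).
  rewrite zE dE pevC /qelt !pevZ fmorphV; field.
  by rewrite fmorph_eq0.
move=> /irreducible_factor[p [irp /dvdpP[e dE]]].
have e0 : e != 0 by apply: contraNneq d0 => e0; rewrite dE e0 mul0r.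
have p0 := irredp_neq0 irp; have [S pS] := places irp.
have ez : elt f g = pev p * (pev e * z).
  rewrite zE dE pevM /qelt; field.
  by rewrite !(pev_eq0 QE) p0 e0.
have [|/dvdpP[f' fE] /dvdpP[g' gE]] := @places_over_power p S 1 f g irp pS.
- move=> P; case: (pS) => _ memS _ _ _; rewrite memS => hP.
  have hy := vge_of_pev irp.1 hP; rewrite mulr1n ez -[ord _ _]addr0; apply: vgeM.
    exact: vge_ordE.
  by rewrite -[0]addr0; apply: vgeM; [exact: vge_pev|exact: hz].
- apply: (IH e f' g') => //.
    rewrite -/(elt f' g'); rewrite expr1 in fE gE.
    have : pev p * elt f' g' = pev p * (pev e * z).
      by rewrite -ez fE gE /qelt !pevE; ring.
    move/mulfI; rewrite (pev_eq0 QE) => /(_ p0) ->; field.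
    by rewrite (pev_eq0 QE).
  have sp := irp.1; have se : (0 < size e)%N by rewrite size_poly_gt0.
  move: sd sp se; rewrite dE size_mul //; clear.
  by move: (size e) (size p) => a b; lia.
Qed.

Lemma finite_residue_degree P : vge P 0 y ->
  exists n, isdim iota (valuation_ring P) (maximal_ideal P) n.
Proof.
move=> /place_over_irreducible[p [irp hp]]; have [S [_ memS hS _ _]] := places irp.
by apply: hS; rewrite memS.
Qed.

End QuadraticIntegrality.

(** * The curve in the coordinates y and 1/y *)

Section Reversal.
Variables (K F : fieldType) (iota : {rmorphism K -> F}).
Implicit Types f : {poly K}.

(** The reciprocal polynomial Y^n f(1/Y), for f of degree at most n. *)
Definition rev_poly n f : {poly K} := \poly_(j < n.+1) f`_(n - j).

Lemma coef_rev_poly n f i : (i <= n)%N -> (rev_poly n f)`_(n - i) = f`_i.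
Proof. by move=> h; rewrite coef_poly ltnS leq_subr subKn. Qed.

Lemma rev_poly_eq0 n f : (size f <= n.+1)%N -> rev_poly n f = 0 -> f = 0.
Proof.
move=> sf h; apply/polyP => i; rewrite coef0; have [hi|hi] := leqP i n.
  by rewrite -(coef_rev_poly f hi) h coef0.
by rewrite nth_default //; apply: leq_trans sf hi.
Qed.

Lemma pev_rev n f (y : F) : y != 0 -> (size f <= n.+1)%N ->
  pval iota y f * y^-1 ^+ n = pval iota y^-1 (rev_poly n f).
Proof.
move=> y0 sf; rewrite {1}/pval horner_map_sum (big_ord_widen _ (fun i => iota f`_i * y ^+ i) sf).
rewrite big_mkcond mulr_suml /rev_poly poly_def pev_sum (reindex_inj rev_ord_inj) /=.
apply: eq_bigr => i _; rewrite subSS pevZ pevX pev_X.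
have hi : (n - i <= n)%N by apply: leq_subr.
have -> : (if (n - i < size f)%N then iota f`_(n - i) * y ^+ (n - i) else 0) =
    iota f`_(n - i) * y ^+ (n - i).
  by case: ltnP => // h; rewrite nth_default // rmorph0 mul0r.
rewrite -mulrA; congr (_ * _).
have : (i <= n)%N by rewrite -ltnS.
move: (nat_of_ord i) => j in'; by rewrite -[X in _ * _ ^+ X](subnK in') exprD mulrA -exprMn mulfV // expr1n mul1r.
Qed.

End Reversal.

(** * The affine curve (x - b1)(x - b2) = y^m x *)

Section Curve.
Variables (K F : fieldType) (iota : {rmorphism K -> F}).
Variables (x y : F) (m : nat) (b1 b2 : K).
Hypotheses (m_gt0 : (0 < m)%N) (mK : m%:R != 0 :> K).
Hypotheses (b12 : b1 != b2) (b1_neq0 : b1 != 0) (b2_neq0 : b2 != 0).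
Hypotheses (x_tr : transcendental iota x) (xy_gen : generated_by iota x y).
Hypothesis y_eq : (x - iota b1) * (x - iota b2) = y ^+ m * x.

Definition curve_trace : {poly K} := (b1 + b2)%:P + 'X^m.
Definition curve_norm : {poly K} := (b1 * b2)%:P.
Local Notation T := curve_trace.
Local Notation N := curve_norm.
Local Notation pev := (pval iota y).

Lemma curve_quad_eq : x ^+ 2 = pev T * x - pev N.
Proof.
rewrite /T /N !pevE rmorphD rmorphM mulrDl -y_eq; ring.
Qed.

(** x is a root of a monic polynomial over K[y], so it would be algebraic over K if y were. *)
Lemma y_transcendental f : pev f = 0 -> f = 0.
Proof.
move=> hf; apply: contrapT => /eqP f0; apply: x_tr.
have /integral_algebraic y_int : algebraicOver iota y by exists f => //; apply/rootP.
have hpev g : integralOver iota (pev g).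
  rewrite /pval; apply: integral_horner => //.
  by apply/integral_poly => i; rewrite coef_map; apply: integral_id.
apply/integral_algebraic.
apply: (@integral_root_monic _ _ _ _ ('X^2 - ((pev T)%:P * 'X + (- pev N)%:P))).
- rewrite monicE lead_coefDl ?lead_coefXn // size_polyXn size_polyN size_MXaddC.
  by case: ifP => // _; rewrite !ltnS size_polyC_leq1.
- by apply/rootP; rewrite !hornerE curve_quad_eq subrr.
- apply/integral_poly => i; rewrite coefB coefXn coefD coefCM coefX coefC.
  apply: integral_sub; first exact: integral_nat.
  apply: integral_add; first by apply: integral_mul; [exact: hpev|exact: integral_nat].
  by case: ifP => _; [apply: integral_opp; exact: hpev|exact: integral0].
Qed.

(** Irreducibility of the quadratic over K(y), for a putative root x = - f / g in lowest terms. As N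
    is a nonzero constant, g divides f^2 and f divides g^2, so both are constants; but then the term
    T f g alone contributes to y^m. *)
Lemma curve_norm_const f g : f != 0 -> g != 0 -> coprimep f g ->
  f ^+ 2 + T * f * g + N * g ^+ 2 = 0 -> False.
Proof.
move=> f0 g0 cop E.
have N0 : b1 * b2 != 0 by rewrite mulf_neq0.
have gf : g %| f ^+ 2.
  have -> : f ^+ 2 = - (T * f + N * g) * g; last exact: dvdp_mulIr.
  by apply/eqP; rewrite -subr_eq0 -[X in _ == X]E; apply/eqP; ring.
have fg : f %| g ^+ 2.
  rewrite -(dvdpZr _ _ N0) -mul_polyC -/N.
  have -> : N * g ^+ 2 = - (f + T * g) * f; last exact: dvdp_mulIr.
  by apply/eqP; rewrite -subr_eq0 -[X in _ == X]E; apply/eqP; ring.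
have g1 : g %| 1.
  by rewrite -(@Gauss_dvdpr _ 1 (f ^+ 2) g) ?mulr1 // coprimep_expr // coprimep_sym.
have f1 : f %| 1.
  by rewrite -(@Gauss_dvdpr _ 1 (g ^+ 2) f) ?mulr1 // coprimep_expr.
move: f1 g1; rewrite !dvdp1 => /size_poly1P[c c0 fE] /size_poly1P[d d0 gE].
move/(congr1 (fun q : {poly K} => q`_m)): E.
rewrite fE gE /T /N -!rmorphXn -mulrA -!rmorphM !coefD coefMC !coefD !coefC coefXn eqxx.
rewrite (gtn_eqF m_gt0) /= !add0r mul1r addr0 => /eqP.
by rewrite mulf_eq0 (negPf c0) (negPf d0).
Qed.

Lemma curve_quad_free f g : pev f + pev g * x = 0 -> f = 0 /\ g = 0.
Proof.
have [->|g0] := eqVneq g 0.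
  by rewrite pev0 mul0r addr0 => /y_transcendental.
move=> h; exfalso.
have x0 : x != 0.
  by apply/eqP => x0; apply: x_tr; rewrite x0; apply: algebraic0.
have gy : pev g != 0 by apply: contra_neq g0; apply: y_transcendental.
have f0 : f != 0.
  apply/eqP => f0; move/eqP: h; rewrite f0 pev0 add0r mulf_eq0.
  by rewrite (negPf gy) (negPf x0).
pose d := gcdp f g.
have d0 : d != 0 by rewrite gcdp_eq0 negb_and f0.
have /dvdpP[f' fE] : d %| f by apply: dvdp_gcdl.
have /dvdpP[g' gE] : d %| g by apply: dvdp_gcdr.
have f'0 : f' != 0 by apply: contraNneq f0 => e; rewrite fE e mul0r.
have g'0 : g' != 0 by apply: contraNneq g0 => e; rewrite gE e mul0r.
have cop : coprimep f' g'.
  have := coprimep_div_gcd (p := f) (q := g); rewrite f0 /= => /(_ isT).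
  by rewrite -/d [in f %/ d]fE [in g %/ d]gE !mulpK.
apply: (curve_norm_const f'0 g'0 cop); apply: y_transcendental.
have dy : pev d != 0 by apply: contra_neq d0; apply: y_transcendental.
have h' : pev f' = - pev g' * x.
  apply: (mulfI dy); move/eqP: h; rewrite addr_eq0 fE gE !pevM => /eqP h.
  by rewrite mulrC h; ring.
have := curve_quad_eq; rewrite /T /N !pevE h' => E.
transitivity (pev g' ^+ 2 * (x ^+ 2 - ((iota (b1 + b2) + y ^+ m) * x - iota (b1 * b2)))).
  by ring.
by rewrite E subrr mulr0.
Qed.

(** These fractions form a subfield containing K, x and y. The inverse is the conjugate over the
    norm, and the norm is nonzero by [curve_quad_free]. *)
Lemma curve_quad_gen z : exists f g d,
  d != 0 /\ z = (pev f + pev g * x) / pev d.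
Proof.
have pev_neq0 d : d != 0 -> pev d != 0.
  by apply: contra_neq; apply: y_transcendental.
pose S z := exists f g d, d != 0 /\ z = (pev f + pev g * x) / pev d.
have SM u v : S u -> S v -> S (u * v).
  move=> [f [g [d [d0 ->]]]] [f' [g' [d' [d'0 ->]]]].
  exists (f * f' - g * g' * N), (f * g' + g * f' + g * g' * T), (d * d').
  split; first by rewrite mulf_neq0.
  rewrite pevM mulf_div; congr (_ / _).
  transitivity (pev f * pev f' + (pev f * pev g' + pev g * pev f') * x + pev g * pev g' * x ^+ 2).
    by ring.
  by rewrite curve_quad_eq !(pevD, pevN, pevM); ring.
have SB u v : S u -> S v -> S (u - v).
  move=> [f [g [d [d0 ->]]]] [f' [g' [d' [d'0 ->]]]].
  exists (f * d' - f' * d), (g * d' - g' * d), (d * d').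
  split; first by rewrite mulf_neq0.
  rewrite !(pevD, pevN, pevM); field.
  by rewrite !pev_neq0.
have SC f : S (pev f).
  exists f, 0, 1; split; first exact: oner_neq0.
  by rewrite pev0 pev1 mul0r addr0 divr1.
have SV u : S u -> S u^-1.
  move=> [f [g [d [d0 ->]]]]; have [e|n0] := eqVneq (pev f + pev g * x) 0.
    by rewrite e mul0r invr0 -(pev0 iota y); apply: SC.
  pose nm := f ^+ 2 + f * g * T + g ^+ 2 * N.
  have nmE : (pev f + pev g * x) * (pev (f + g * T) - pev g * x) = pev nm.
    transitivity (pev f * pev (f + g * T) + (pev g * pev (f + g * T) - pev f * pev g) * x -
        pev g ^+ 2 * x ^+ 2); first by ring.
    by rewrite curve_quad_eq /nm !(pevD, pevN, pevM, pevX); ring.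
  have nm0 : pev nm != 0.
    rewrite -nmE mulf_neq0 //; apply: contra_neq n0 => h.
    have [] := curve_quad_free (f := f + g * T) (g := - g); first by rewrite pevN mulNr.
    move=> + /eqP; rewrite oppr_eq0 => + /eqP g0; rewrite g0 mul0r addr0 => ->.
    by rewrite pev0 mul0r addr0.
  exists (d * (f + g * T)), (- (d * g)), nm; split.
    by apply: contra_neq nm0 => ->; rewrite pev0.
  rewrite invf_div; apply: (canRL (mulfK nm0)); rewrite -nmE.
  rewrite mulrA divfK //.
  by rewrite !(pevN, pevM); ring.
have Sx : S x.
  exists 0, 1, 1; split; first exact: oner_neq0.
  by rewrite pev0 pev1 mul1r add0r divr1.
suff h : forall z, z \in [pred z | `[< S z >]] by have := h z; rewrite inE.
apply: xy_gen.
- split; rewrite ?inE.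
  + by rewrite -(pev1 iota y); apply: SC.
  + by move=> u v; rewrite !inE; apply: SB.
  + by move=> u v; rewrite !inE => hu hv; apply: SM => //; apply: SV.
- by move=> c; rewrite inE -(pevC iota y); apply: SC.
- by rewrite inE.
- by rewrite inE -{1}(pev_X iota y); apply: SC.
Qed.

Lemma curve_quadratic : quadratic_ext iota x y T N.
Proof. by split; [exact: curve_quad_eq|exact: curve_quad_free|exact: curve_quad_gen]. Qed.

(* If p^2 divides h^2 - T h + N, then p divides its derivative, and so         *)
(* m y^(m-1) h; as p does not divide h, it divides y, where the roots b1 and   *)
(* b2 are distinct.                                                            *)
Lemma curve_smooth p h : irreducible_poly p ->
  p %| charpoly_value T N h -> p %| h + h - T -> ~~ (p ^+ 2 %| charpoly_value T N h).
Proof.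
move=> irp h1 h2; apply/negP => /dvdpP[k E].
have ndvdC (c : K) : c != 0 -> ~~ (p %| c%:P).
  by move=> c0; rewrite -[c%:P]mulr1 mul_polyC dvdpZr // dvdp1 gtn_eqF // irp.1.
have hh : ~~ (p %| h).
  apply: contra (ndvdC (b1 * b2) _) => [hh|]; last by rewrite mulf_neq0.
  by apply: (dvdp_comb (u := 1) (v := - (h - T)) h1 hh); rewrite /charpoly_value /N; ring.
have hX : p %| 'X.
  have : p %| (m%:R)%:P * ('X^(m.-1) * h).
    have := congr1 (@deriv K) E; rewrite /charpoly_value /N /T.
    rewrite !expr2 !(derivD, derivB, derivN, derivM, derivC, derivXn) => E'.
    apply: (dvdp_comb (u := h^`()) (v := - (k^`() * p + k * p^`() *+ 2)) h2 (dvdpp p)).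
    move/eqP: E'; rewrite -subr_eq0 => /eqP E'; apply/eqP.
    rewrite eq_sym -subr_eq0 -[X in _ == X]E' polyC_natr -mulr_natl /T; apply/eqP; ring.
  rewrite irreducible_dvdM // (negPf (ndvdC _ mK)) irreducible_dvdM // (negPf hh) orbF /=.
  elim: (m.-1) => [|j IH]; first by rewrite expr0 dvdp1 gtn_eqF // irp.1.
  by rewrite exprS irreducible_dvdM // => /orP[].
have hXm : p %| 'X^m by rewrite -(prednK m_gt0) exprS dvdp_mulr.
have hb : p %| (h - b1%:P) * (h - b2%:P).
  apply: (dvdp_comb (u := 1) (v := h) h1 hXm).
  by rewrite /charpoly_value /T /N polyCD polyCM; ring.
have hs : p %| h + h - b1%:P - b2%:P.
  by apply: (dvdp_comb (u := 1) (v := 1) h2 hXm); rewrite /T polyCD; ring.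
have b12' : b1 - b2 != 0 by rewrite subr_eq0.
have /negP := ndvdC _ b12'; apply.
move: hb; rewrite irreducible_dvdM // => /orP[hb|hb].
- by apply: (dvdp_comb (u := 1) (v := - 2) hs hb); rewrite polyCB; ring.
- by apply: (dvdp_comb (u := -1) (v := 2) hs hb); rewrite polyCB; ring.
Qed.

End Curve.

Lemma mulrn_int (a : int) n : a *+ n = a * n%:Z.
Proof. by rewrite -mulr_natr natz. Qed.

Lemma dvdp_XnP (K : fieldType) n (f : {poly K}) i : 'X^n %| f -> (i < n)%N -> f`_i = 0.
Proof. by move=> /dvdpP[q ->] hi; rewrite coefMXn hi. Qed.

Lemma dvdp_X_horner (K : fieldType) (f : {poly K}) : ('X %| f) = (f.[0] == 0).
Proof. by rewrite -['X]subr0 -polyC0 dvdp_XsubCl; apply/rootP/eqP. Qed.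

Lemma irreducible_X (K : fieldType) : irreducible_poly ('X : {poly K}).
Proof. by rewrite -['X]subr0 -polyC0; apply: irredp_XsubC. Qed.

(** * The chart 1/y and the spaces L(n (y)_oo) *)

Section CurveAtInfinity.
Variables (K F : fieldType) (iota : {rmorphism K -> F}).
Variables (x y : F) (m : nat) (b1 b2 : K).
Hypothesis m_gt0 : (0 < m)%N.
Hypothesis QE : quadratic_ext iota x y (curve_trace m b1 b2) (curve_norm b1 b2).
Implicit Types (f g h p d : {poly K}) (P : place iota).

Local Notation T := (curve_trace m b1 b2).
Local Notation N := (curve_norm b1 b2).
Local Notation pev := (pval iota y).
Local Notation elt := (qelt iota x y).
Local Notation w := (y^-1).
Local Notation x' := (x * y^-1 ^+ m).

Lemma curve_y_neq0 : y != 0.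
Proof. by rewrite -(pev_X iota y) (pev_eq0 QE) polyX_eq0. Qed.

Let y0 := curve_y_neq0.

(* Trace and norm of x y^-m over K(1/y), as polynomials in 1/y. *)
Definition inf_trace : {poly K} := 1 + (b1 + b2) *: 'X^m.
Definition inf_norm : {poly K} := (b1 * b2) *: 'X^(m + m).

Lemma pev_rev_inv n f : (size f <= n.+1)%N ->
  pval iota w f * y ^+ n = pev (rev_poly n f).
Proof.
by move=> sf; have := pev_rev iota (y := w) (n := n) (f := f); rewrite invrK; apply; rewrite // invr_eq0.
Qed.

(** Change of chart, with M a common degree bound. Since x = x' y^m, the first coordinate keeps an
    extra factor w^m. *)
Lemma elt_inf M f g : (size f <= M.+1)%N -> (size g <= M.+1)%N ->
  elt f g * w ^+ (M + m) = qelt iota x' w (rev_poly M f * 'X^m) (rev_poly M g).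
Proof.
move=> sf sg; rewrite /qelt pevM pevX pev_X -!(pev_rev _ y0) // exprD; ring.
Qed.

Lemma inf_quadratic : quadratic_ext iota x' w inf_trace inf_norm.
Proof.
split.
- rewrite exprMn (quad_eq QE) /inf_trace /inf_norm /curve_trace /curve_norm !pevE exprD.
  have yw : y ^+ m * w ^+ m = 1 by rewrite -exprMn mulfV // expr1n.
  rewrite expr2; transitivity ((iota (b1 + b2) * (w ^+ m) + y ^+ m * w ^+ m) * (x * w ^+ m)
    - iota (b1 * b2) * (w ^+ m * w ^+ m)); first by ring.
  by rewrite yw; ring.
- move=> f g h; pose M := (size f + size g)%N.
  have sf : (size f <= (M + m).+1)%N by rewrite /M; apply: leq_trans (leqnSn _); rewrite -addnA leq_addr.
  have sg : (size g <= M.+1)%N by apply: leq_trans (leqnSn _); rewrite leq_addl.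
  have [] := quad_free QE (f := rev_poly (M + m) f) (g := rev_poly M g).
    rewrite -!pev_rev_inv //.
    have : (pval iota w f + pval iota w g * x') * y ^+ (M + m) = 0 by rewrite h mul0r.
    have yw : w ^+ m * y ^+ m = 1 by rewrite -exprMn mulVf // expr1n.
    move=> <-; rewrite exprD.
    transitivity (pval iota w f * (y ^+ M * y ^+ m) + pval iota w g * y ^+ M * x * (w ^+ m * y ^+ m)).
      by rewrite yw mulr1.
    by ring.
  by move=> /(rev_poly_eq0 sf) -> /(rev_poly_eq0 sg) ->.
- move=> z; have [f [g [d [d0 ->]]]] := quad_gen QE z.
  pose M := (size f + size g + size d)%N.
  have sf : (size f <= M.+1)%N by apply: leq_trans (leqnSn _); rewrite /M -addnA leq_addr.
  have sg : (size g <= M.+1)%N by apply: leq_trans (leqnSn _); rewrite /M addnAC leq_addl.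
  have sd : (size d <= M.+1)%N by apply: leq_trans (leqnSn _); rewrite leq_addl.
  exists (rev_poly M f * 'X^m), (rev_poly M g), (rev_poly M d * 'X^m).
  have rd : rev_poly M d != 0 by apply: contra_neq d0; apply: rev_poly_eq0.
  split; first by rewrite mulf_neq0 // -size_poly_eq0 size_polyXn.
  rewrite -/(qelt iota x' w _ _) -elt_inf // pevM pevX pev_X -(pev_rev _ y0) //.
  have -> : pev d * w ^+ M * w ^+ m = pev d * w ^+ (M + m) by rewrite exprD mulrA.
  rewrite -/(elt f g).
  by rewrite -mulf_div divff ?mulr1 // expf_neq0 // invr_eq0.
Qed.

(* At 1/y = 0 the characteristic polynomial is h^2 - h, with simple roots. *)
Lemma inf_smooth h : 'X %| charpoly_value inf_trace inf_norm h -> 'X %| h + h - inf_trace -> False.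
Proof.
rewrite !dvdp_X_horner /charpoly_value /inf_trace /inf_norm !hornerE.
rewrite !expr0n addn_eq0 (gtn_eqF m_gt0) /= !mulr0 !addr0 => /eqP h1 /eqP h2.
have : (1 : K) = 0; last by move/eqP; rewrite oner_eq0.
move: h1 h2; move: (h.[0]) => a h1 h2.
(* The discriminant of h^2 - h is 1, in characteristic 2 too. *)
transitivity ((a + a - 1) * (a + a - 1) - 4 * (a ^+ 2 - 1 * a)); first by ring.
by rewrite h1 h2; ring.
Qed.

Lemma exists_inf_places : exists S : seq (place iota), places_over x' w 'X S.
Proof.
apply: (exists_places_over inf_quadratic); first exact: irreducible_X.
by move=> h h1 h2; case: (inf_smooth h1 h2).
Qed.

Hypothesis places : forall p, irreducible_poly p ->
  exists S : seq (place iota), places_over x y p S.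
Variable S : seq (place iota).
Hypothesis S_inf : places_over x' w 'X S.

Lemma inf_placesE P : (P \in S) = (ord P y < 0).
Proof. by case: S_inf => _ -> _ _ _; rewrite pev_X ordV oppr_gt0. Qed.

Lemma ord_pole_divisor P : pole_divisor y P = if P \in S then - ord P y else 0.
Proof.
rewrite inf_placesE /pole_divisor -/(ord P y); case: ltP => h.
  by apply/max_idPr; rewrite oppr_ge0 ltW.
by apply/max_idPl; rewrite oppr_le0.
Qed.

(** x = x' y^m, and x' is integral over K[1/y]. *)
Lemma vge_inf_x P : P \in S -> vge P (ord P y *+ m) x.
Proof.
rewrite inf_placesE => hy.
have hw : vge P 0 w by apply/vgeP => _; rewrite ordV oppr_ge0 ltW.
have := vge_x inf_quadratic hw.
have e : ord P (w ^+ m) = - (ord P y *+ m) by rewrite ordX ordV mulNrn.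
rewrite mulrC (vgeMl _ _ _ e); last by rewrite expf_neq0 // invr_eq0.
by rewrite sub0r opprK.
Qed.

Definition multiple_pole (n : nat) : place iota -> int := fun P => n%:Z * pole_divisor y P.

Lemma vge_inf_pev P n f : P \in S -> (size f <= n.+1)%N -> vge P (ord P y *+ n) (pev f).
Proof.
rewrite inf_placesE => hy sf; apply/vgeP => hf.
have f0 : f != 0 by rewrite -(pev_eq0 QE).
have [_ ->] := ord_pev_pole hy f0.
have : ((size f).-1 <= n)%N by rewrite -ltnS prednK // size_poly_gt0.
by rewrite !mulrn_int ler_nM2l.
Qed.

(** Regularity where y is regular gives z = f + g x; the pole bound at infinity then becomes
    divisibility of the coordinates in the chart w = 1/y by a power of w, that is, a degree bound.
    For n < m the subtraction [n.+1 - m] truncates to 0 and forces g = 0. *)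
Lemma rr_multiple_poleP n z : riemann_roch_space (multiple_pole n) z <->
  exists f g, [/\ z = elt f g, (size f <= n.+1)%N & (size g <= n.+1 - m)%N].
Proof.
rewrite /riemann_roch_space /=; split => [hz|[f [g [-> sf sg]]] P].
- have [P hP|f [g zE]] := integral_elt QE places (z := z).
    have := hz P; rewrite /multiple_pole ord_pole_divisor inf_placesE.
    by move: hP; rewrite vge_ord // => hP; rewrite ltNge hP /= mulr0 oppr0.
  exists f, g; pose M := (size f + size g + n + m)%N.
  have sf : (size f <= M.+1)%N by rewrite /M; lia.
  have sg : (size g <= M.+1)%N by rewrite /M; lia.
  (* z has order at least - n ord w at infinity, so z w^(M + m) is divisible by w^(M + m - n). The
     coefficient of index i sits at index M - i + m for f and M - i for g; it vanishes for i > n,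
     respectively i > n - m. *)
  have [|hf hg] := @places_over_power _ _ _ _ _ _ _ inf_quadratic 'X S (M + m - n)
      (rev_poly M f * 'X^m) (rev_poly M g) (irreducible_X K) S_inf.
    move=> P PS; rewrite -elt_inf // -zE pev_X ordV mulrC.
    have e : ord P (w ^+ (M + m)) = - (ord P y *+ (M + m)) by rewrite ordX ordV mulNrn.
    rewrite (vgeMl _ _ _ e); last by rewrite expf_neq0 // invr_eq0.
    have := hz P; rewrite /multiple_pole ord_pole_divisor PS.
    apply: vge_trans; rewrite !mulrn_int.
    have : (n <= M + m)%N by rewrite /M; lia.
    move: (M + m)%N (ord P y) => k a nk; rewrite -subzn //.
    by have -> : - a * (k%:Z - n%:Z) - - (a * k%:Z) = - (n%:Z * - a) by ring.
  split => //; apply/leq_sizeP => i hi.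
    have [iM|iM] := leqP i M; last by rewrite nth_default //; apply: leq_trans sf iM.
    rewrite -(coef_rev_poly f iM).
    have <- : (rev_poly M f * 'X^m)`_(M - i + m) = (rev_poly M f)`_(M - i).
      by rewrite coefMXn ltnNge leq_addl /= addnK.
    by apply: (dvdp_XnP hf); lia.
  have [iM|iM] := leqP i M; last by rewrite nth_default //; apply: leq_trans sg iM.
  by rewrite -(coef_rev_poly g iM); apply: dvdp_XnP hg _; lia.
- rewrite /multiple_pole ord_pole_divisor; case: ifP => PS; last first.
    rewrite mulr0 oppr0; apply: (vge_elt QE); rewrite vge_ord //.
    by rewrite leNgt -inf_placesE PS.
  have -> : - (n%:Z * - ord P y) = ord P y *+ n by rewrite mulrN opprK -mulr_natl natz.
  apply: vgeD; first exact: vge_inf_pev.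
  have [->|g0] := eqVneq g 0; first by rewrite pev0 mul0r vge0.
  have sg0 : (0 < size g)%N by rewrite size_poly_gt0.
  have [mn sg'] : (m <= n)%N /\ (size g <= (n - m).+1)%N.
    by move: sg sg0; clear; move: (size g) => s; lia.
  have -> : ord P y *+ n = ord P y *+ (n - m) + ord P y *+ m.
    by rewrite -mulrnDr subnK.
  by apply: vgeM; [exact: vge_inf_pev|exact: vge_inf_x].
Qed.

(** By [ord_pev_pole] applied to z, an algebraic element has no pole, so it lies in L(0), which is K
    because m > 0. *)
Lemma curve_constants z : algebraicOver iota z -> exists c, z = iota c.
Proof.
move=> [p p0 /rootP pz].
have : riemann_roch_space (multiple_pole 0) z.
  move=> P; rewrite /multiple_pole mul0r oppr0; apply/vgeP => z0; rewrite leNgt.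
  apply/negP => hz; have [] := ord_pev_pole hz p0.
  by rewrite /pval pz eqxx.
move=> /rr_multiple_poleP[f [g [zE sf sg]]].
have g0 : g = 0 by apply/eqP; rewrite -size_poly_leq0; apply: leq_trans sg _; lia.
exists f`_0; rewrite zE g0 elt_pev {1}(size1_polyC sf).
by rewrite pevC.
Qed.

Lemma rr_multiple_pole_dim n :
  isdim iota (riemann_roch_space (multiple_pole n)) [set 0] (n.+1 + (n.+1 - m)).
Proof.
exists (cat_fam (fun i : 'I_n.+1 => pev 'X^i) (fun i : 'I_(n.+1 - m) => pev 'X^i * x)).
have combE c : comb iota c (cat_fam (fun i : 'I_n.+1 => pev 'X^i)
    (fun i : 'I_(n.+1 - m) => pev 'X^i * x)) =
    elt (\sum_i c (lshift _ i) *: 'X^i) (\sum_i c (rshift _ i) *: 'X^i).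
  rewrite comb_cat /qelt !pev_sum mulr_suml; congr (_ + _); apply: eq_bigr => i _.
    by rewrite pevZ.
  by rewrite pevZ mulrA.
split.
- apply: cat_famP => i; apply/rr_multiple_poleP.
    by exists 'X^i, 0; rewrite elt_pev size_polyXn size_poly0.
  by exists 0, 'X^i; rewrite /qelt pev0 add0r size_polyXn size_poly0.
- move=> c; rewrite -/(comb _ _ _) combE /= => h.
  have [] := quad_free QE h.
  have [f [-> _ fc]] := sum_monomialsE (fun i => c (lshift (n.+1 - m) i)).
  have [g [-> _ gc]] := sum_monomialsE (fun i => c (rshift n.+1 i)).
  move=> f0 g0 i; case: (splitP i) => j ij.
    by rewrite (_ : i = lshift _ j) -?fc ?f0 ?coef0 //; apply: val_inj.
  by rewrite (_ : i = rshift _ j) -?gc ?g0 ?coef0 //; apply: val_inj.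
- move=> z /rr_multiple_poleP[f [g [-> sf sg]]].
  have [c [cl cr]] := split_comb (fun i : 'I_n.+1 => f`_i) (fun i : 'I_(n.+1 - m) => g`_i).
  exists c; rewrite -/(comb _ _ _) combE /=.
  have trunc k (h : {poly K}) : (size h <= k)%N -> \sum_(i < k) h`_i *: 'X^i = h.
    move=> sh; rewrite -poly_def; apply/polyP => i; rewrite coef_poly.
    by case: ltnP => // ki; rewrite nth_default //; apply: leq_trans sh ki.
  have -> : \sum_i c (lshift _ i) *: 'X^i = f.
    by rewrite -[RHS](trunc _ _ sf); apply: eq_bigr => i _; rewrite cl.
  have -> : \sum_i c (rshift _ i) *: 'X^i = g.
    by rewrite -[RHS](trunc _ _ sg); apply: eq_bigr => i _; rewrite cr.
  by rewrite subrr.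
Qed.

End CurveAtInfinity.

(** * Divisors and Riemann-Roch spaces *)

Section Divisors.
Variables (K F : fieldType) (iota : {rmorphism K -> F}).
Implicit Types (A B : place iota -> int) (P : place iota).

Definition supported_on (s : seq (place iota)) A : Prop := forall P, P \notin s -> A P = 0.

Lemma supported_on_divisor s A : uniq s -> supported_on s A ->
  is_divisor A /\ divisor_degree A = \sum_(P <- s) A P * (place_degree P)%:Z.
Proof.
move=> us hs; split.
  apply: (@sub_finite_set _ _ [set` s]) => [P /= hP|]; last exact: finite_seq.
  by apply: contraNT hP => /hs ->.
rewrite /divisor_degree (@fsbigE _ _ _ _ _ s _ us) //.
  by apply: eq_bigl => P; rewrite in_setT.
by move=> P _ hP; rewrite hs // mul0r.
Qed.

Lemma divisor_support A B : is_divisor A -> is_divisor B ->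
  exists s, [/\ uniq s, supported_on s A & supported_on s B].
Proof.
move=> /finite_seqP[s hs] /finite_seqP[s' hs']; exists (undup (s ++ s')); split.
- exact: undup_uniq.
- move=> P; rewrite mem_undup mem_cat negb_or => /andP[hP _].
  apply/eqP; apply: contraNT hP => hA.
  by have : [set P | A P != 0] P by []; rewrite hs.
- move=> P; rewrite mem_undup mem_cat negb_or => /andP[_ hP].
  apply/eqP; apply: contraNT hP => hA.
  by have : [set P | B P != 0] P by []; rewrite hs'.
Qed.

Lemma divisorD A B : is_divisor A -> is_divisor B ->
  is_divisor (fun P => A P + B P) /\
  divisor_degree (fun P => A P + B P) = divisor_degree A + divisor_degree B.
Proof.
move=> hA hB; have [s [us sA sB]] := divisor_support hA hB.
have sAB : supported_on s (fun P => A P + B P) by move=> P hP; rewrite sA ?sB.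
have [h1 ->] := supported_on_divisor us sAB; split => //.
rewrite (supported_on_divisor us sA).2 (supported_on_divisor us sB).2 -big_split /=.
by apply: eq_bigr => P _; rewrite mulrDl.
Qed.

Lemma subspace_rr A : subspace iota (riemann_roch_space A).
Proof.
split=> [P|u v hu hv P|c u hu P]; first exact: vge0.
  by apply: vgeD; [exact: hu|exact: hv].
by apply: vgeZ; apply: hu.
Qed.

Lemma subspace0 : subspace iota [set 0].
Proof. by split=> //= [u v -> ->|c u ->]; rewrite ?addr0 ?mulr0. Qed.

Lemma ord_surj_int P (n : int) : exists z, z != 0 /\ ord P z = n.
Proof.
have [t t0 ht] := ord_surj P; case: n => n.
  by exists (t ^+ n); rewrite expf_neq0 // ordX ht natz.
by exists (t ^+ n.+1)^-1; rewrite invr_eq0 expf_neq0 // ordV ordX ht natz NegzE.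
Qed.

(** For t of order A(P0) + 1 at P0, multiplication by t embeds L(A + P0) / L(A) in the residue field
    of P0. *)
Lemma rr_step A B P0 d b :
  (forall P, B P = A P + (P == P0)%:Z) ->
  isdim iota (valuation_ring P0) (maximal_ideal P0) d ->
  isdim iota (riemann_roch_space B) [set 0] b ->
  exists a, isdim iota (riemann_roch_space A) [set 0] a /\ (b <= a + d)%N.
Proof.
move=> hB hd hb.
have AB : riemann_roch_space A `<=` riemann_roch_space B.
  by move=> z hz P; apply: vge_trans (hz P); rewrite hB lerN2 lerDl.
have [a _ ha] : exists2 a, (a <= b)%N & isdim iota (riemann_roch_space A) [set 0] a.
  apply: (dim_inject (z := 1) subspace0 (subspace_rr A) subspace0 hb) => v; rewrite mul1r //.
  exact: AB.
have [t [t0 ht]] := ord_surj_int P0 (A P0 + 1).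
have [k kd hk] : exists2 k, (k <= d)%N &
    isdim iota (riemann_roch_space B) (riemann_roch_space A) k.
  apply: (dim_inject (z := t) (subspace_maximal_ideal P0) (subspace_rr B) (subspace_rr A) hd) => v hv.
    rewrite /valuation_ring /= -/(vge P0 0 (t * v)) (vgeMl _ _ t0 ht) sub0r.
    by have := hv P0; rewrite hB eqxx.
  move/maximal_idealE; rewrite (vgeMl _ _ t0 ht) opprD addrCA subrr addr0 => hv0 P.
  have [->//|PP0] := eqVneq P P0.
  by have := hv P; rewrite hB (negPf PP0) addr0.
exists a; split => //.
have h0A : [set 0] `<=` riemann_roch_space A by move=> z -> P; exact: vge0.
have := dim_add (subspace_rr B) (subspace_rr A) h0A AB hk ha.
by move=> /(dim_unique subspace0 hb) ->; rewrite addnC leq_add2l.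
Qed.

Hypothesis finite_degree : forall P,
  exists n, isdim iota (valuation_ring P) (maximal_ideal P) n.

Lemma place_degree_dim P : isdim iota (valuation_ring P) (maximal_ideal P) (place_degree P).
Proof. by have [n hn] := finite_degree P; rewrite (place_degreeE hn). Qed.

Lemma rr_steps (k : nat) A B P0 b :
  (forall P, B P = A P + (if P == P0 then k%:Z else 0)) ->
  isdim iota (riemann_roch_space B) [set 0] b ->
  exists a, isdim iota (riemann_roch_space A) [set 0] a /\ (b <= a + k * place_degree P0)%N.
Proof.
elim: k A => [|k IH] A hB hb.
  exists b; split; last by rewrite mul0n addn0.
  suff -> : A = B by [].
  by apply/funext => P; rewrite hB if_same addr0.
have [|a' [ha' hle]] := IH (fun P => A P + (P == P0)%:Z) _ hb.
  by move=> P; rewrite hB; case: eqP => _ /=; rewrite ?addr0 // -addrA -PoszD add1n.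
have [a [ha hle']] := rr_step (fun P => erefl) (place_degree_dim P0) ha'.
by exists a; split => //; rewrite mulSn; lia.
Qed.

(** Adding one place at a time from A to B gives l(B) - l(A) <= deg (B - A), so deg A - l(A) is
    monotone in A. *)
Lemma rr_dim_mono s A B b : uniq s -> (forall P, A P <= B P) ->
  (forall P, P \notin s -> A P = B P) ->
  isdim iota (riemann_roch_space B) [set 0] b ->
  exists a, isdim iota (riemann_roch_space A) [set 0] a /\
    b%:Z <= a%:Z + \sum_(P <- s) (B P - A P) * (place_degree P)%:Z.
Proof.
move=> + + + hb; elim: s A => [|P0 s IH] A /= us AB hs.
  exists b; rewrite big_nil addr0; split => //.
  by suff -> : A = B by []; apply/funext => P; apply: hs.
have /andP[P0s us'] := us.
pose A' P := if P == P0 then B P else A P.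
have [P|P hP|a' [ha' hle]] := IH A' us'.
- by rewrite /A'; case: eqP.
- rewrite /A'; case: eqP => // /eqP PP0.
  by apply: hs; rewrite inE negb_or PP0.
have [|a [ha hle']] := @rr_steps `|B P0 - A P0|%N A A' P0 _ _ ha'.
  move=> P; rewrite /A'; case: eqP => [->|_]; last by rewrite addr0.
  by rewrite gez0_abs ?subr_ge0 // [RHS]addrC subrK.
exists a; split => //; rewrite big_cons.
have e : \sum_(P <- s) (B P - A' P) * (place_degree P)%:Z =
    \sum_(P <- s) (B P - A P) * (place_degree P)%:Z.
  apply: eq_big_seq => P Ps; rewrite /A'; case: eqP => // PP0.
  by rewrite -PP0 Ps in P0s.
rewrite e in hle; apply: le_trans hle _; rewrite addrA lerD2r.
have -> : B P0 - A P0 = `|B P0 - A P0|%N%:Z by rewrite gez0_abs ?subr_ge0.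
rewrite -PoszM -PoszD lez_nat.
exact: hle'.
Qed.

End Divisors.

(** * The genus *)

Section CurveGenus.
Variables (K F : fieldType) (iota : {rmorphism K -> F}).
Variables (x y : F) (m : nat) (b1 b2 : K).
Hypothesis m_gt0 : (0 < m)%N.
Hypothesis QE : quadratic_ext iota x y (curve_trace m b1 b2) (curve_norm b1 b2).
Hypothesis places : forall p, irreducible_poly p ->
  exists S : seq (place iota), places_over x y p S.
Implicit Types (f g h p d : {poly K}) (P : place iota) (A : place iota -> int).
Variable S : seq (place iota).
Hypothesis S_inf : places_over (x * y^-1 ^+ m) (y^-1) 'X S.

Local Notation pev := (pval iota y).

Lemma notin_inf_places P : P \notin S -> vge P 0 y.
Proof.
by rewrite (inf_placesE S_inf) -leNgt vge_ord ?(curve_y_neq0 QE).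
Qed.

Lemma finite_degree P : exists n, isdim iota (valuation_ring P) (maximal_ideal P) n.
Proof.
have [PS|/notin_inf_places] := boolP (P \in S); last exact: finite_residue_degree QE places P.
by case: S_inf => _ _ h _ _; apply: h.
Qed.

Lemma inf_degree : \sum_(P <- S) - ord P y * (place_degree P)%:Z = 2.
Proof.
case: S_inf => _ _ _ + _; rewrite size_polyX mul1n => e.
rewrite -[RHS]/(Posz 2) -e; apply: eq_bigr => P _.
by rewrite pev_X ordV.
Qed.

Lemma multiple_pole_degree n :
  is_divisor (multiple_pole (iota := iota) y n) /\
  divisor_degree (multiple_pole (iota := iota) y n) = n%:Z * 2.
Proof.
have us : uniq S by case: S_inf.
have [|h1 ->] := @supported_on_divisor _ _ _ S (multiple_pole y n) us.
  by move=> P hP; rewrite /multiple_pole (ord_pole_divisor S_inf) (negPf hP) mulr0.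
split => //; rewrite -inf_degree mulr_sumr; apply: eq_big_seq => P PS.
by rewrite /multiple_pole (ord_pole_divisor S_inf) PS mulrA.
Qed.

(** The zeros are the places above p, of total degree 2 deg p; the poles are those of y taken deg p
    times, and (y)_oo has degree 2. *)
Lemma irreducible_degree p : irreducible_poly p ->
  is_divisor (fun P => ord P (pev p)) /\ divisor_degree (fun P => ord P (pev p)) = 0.
Proof.
move=> irp; have [Sp [us memS _ deg _]] := places irp.
have us' : uniq S by case: S_inf.
have p0 := irredp_neq0 irp.
have dis P : P \in S -> P \notin Sp.
  rewrite (inf_placesE S_inf) memS => hy; apply/negP => /(vge_of_pev irp.1).
  by rewrite vge_ord ?(curve_y_neq0 QE) // leNgt hy.
have uss : uniq (Sp ++ S).
  rewrite cat_uniq us us' andbT; apply/hasPn => P; exact: dis.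
have [|h1 ->] := @supported_on_divisor _ _ _ (Sp ++ S) (fun P => ord P (pev p)) uss.
  move=> P; rewrite mem_cat negb_or memS => /andP[h /notin_inf_places hy].
  apply/eqP; rewrite eq_le leNgt h /= -vge_ord ?(pev_eq0 QE) //.
  exact: vge_pev.
split => //; rewrite big_cat deg /=.
have -> : \sum_(P <- S) ord P (pev p) * (place_degree P)%:Z =
    - ((size p).-1%:Z * \sum_(P <- S) - ord P y * (place_degree P)%:Z).
  rewrite mulr_sumr -sumrN; apply: eq_big_seq => P.
  rewrite (inf_placesE S_inf) => hy; have [_ ->] := ord_pev_pole hy p0.
  by rewrite mulrn_int; ring.
by rewrite inf_degree PoszM subrr.
Qed.

Lemma principal_degree d : d != 0 ->
  is_divisor (fun P => ord P (pev d)) /\ divisor_degree (fun P => ord P (pev d)) = 0.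
Proof.
have [n] := ubnP (size d); elim: n d => // n IH d sd d0.
have [s1|] := leqP (size d) 1.
  have [|h1 ->] := @supported_on_divisor _ _ _ [::] (fun P => ord P (pev d)) isT.
    by move=> P _; rewrite (size1_polyC s1) pevC ord_iota.
  by rewrite big_nil.
move=> /irreducible_factor[p [irp /dvdpP[e dE]]].
have e0 : e != 0 by apply: contraNneq d0 => e0; rewrite dE e0 mul0r.
have p0 := irredp_neq0 irp; have sp := irp.1.
have se : (size e < n)%N.
  have : (0 < size e)%N by rewrite size_poly_gt0.
  move: sd sp; rewrite dE size_mul //; clear.
  by move: (size e) (size p) => a b; lia.
have [h1 h2] := irreducible_degree irp; have [h3 h4] := IH e se e0.
have [h5 h6] := divisorD h3 h1.
have -> : (fun P => ord P (pev d)) = (fun P => ord P (pev e) + ord P (pev p)).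
  by apply/funext => P; rewrite dE pevM ordM ?(pev_eq0 QE).
by split => //; rewrite h6 h2 h4.
Qed.

(** Below each place P0 of s that is not a pole of y lies an irreducible p, and the factor p^|A(P0)|
    raises the order there enough. *)
Lemma affine_bound (s : seq (place iota)) A : exists d, d != 0 /\
  forall P, P \in s -> P \notin S -> A P <= ord P (pev d).
Proof.
elim: s => [|P0 s [d [d0 hd]]]; first by exists 1; rewrite oner_neq0.
have [P0S|P0S] := boolP (P0 \in S).
  exists d; split => // P; rewrite inE => /orP[/eqP->|]; first by rewrite P0S.
  exact: hd.
have [p [irp hp]] := place_over_irreducible QE (notin_inf_places P0S).
have p0 := irredp_neq0 irp.
exists (d * p ^+ `|A P0|); split; first by rewrite mulf_neq0 ?expf_neq0.
move=> P hP PS; have hy := notin_inf_places PS.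
rewrite pevM ordM ?(pev_eq0 QE) ?expf_neq0 // pevX ordX mulrn_int.
have h1 : 0 <= ord P (pev d) by rewrite -vge_ord ?(pev_eq0 QE) // vge_pev.
have h2 : 0 <= ord P (pev p) by rewrite -vge_ord ?(pev_eq0 QE) // vge_pev.
move: hP; rewrite inE => /orP[/eqP PP0|Ps].
  rewrite PP0 in h1 *; apply: le_trans (ler_norm _) _; rewrite abszE.
  apply: le_trans (_ : ord P0 (pev p) * `|A P0| <= _); last by rewrite lerDr.
  by rewrite ler_peMl.
by apply: le_trans (hd P Ps PS) _; rewrite lerDl mulr_ge0.
Qed.

Lemma infinite_bound (v a : int) (e n : nat) : v < 0 -> (e + `|a| <= n)%N ->
  a <= n%:Z * - v + v * e%:Z.
Proof.
move=> hv h; apply: le_trans (_ : a <= n%:Z - e%:Z) _; first lia.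
have -> : n%:Z * - v + v * e%:Z = (n%:Z - e%:Z) * - v by ring.
by rewrite ler_peMr; lia.
Qed.

(** A is at most B = n (y)_oo + (d). Division by d turns L(n (y)_oo) into L(B), so deg B = 2 n and
    l(B) = 2 n + 2 - m, and B has the value m - 1; monotonicity transfers the bound to A. *)
Lemma riemann_inequality A : is_divisor A ->
  divisor_degree A - (riemann_roch_dim A)%:Z + 1 <= m%:Z - 1.
Proof.
move=> hA.
have [s [us sA _]] := divisor_support hA hA.
have [d [d0 hd]] := affine_bound s A.
(* The term m makes [n.+1 - m] an exact subtraction; deg d compensates the poles of d at infinity,
   and the sum dominates A there. *)
pose n := (m + (size d).-1 + \sum_(P <- S) `|A P|)%N.
pose B P := multiple_pole y n P + ord P (pev d).
have [hn1 hn2] := multiple_pole_degree n; have [hd1 hd2] := principal_degree d0.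
have [hB1 hB2] := divisorD hn1 hd1.
have AB P : A P <= B P.
  rewrite /B /multiple_pole (ord_pole_divisor S_inf); case: ifP => PS.
    have hy : ord P y < 0 by rewrite -(inf_placesE S_inf).
    have [_ ->] := ord_pev_pole hy d0; rewrite mulrn_int.
    have nA : ((size d).-1 + `|A P| <= n)%N.
      rewrite /n (big_rem P PS) /= -addnA [X in (_ <= X)%N]addnC -!addnA leq_add2l; lia.
    exact: infinite_bound.
  have {}PS : P \notin S by rewrite PS.
  rewrite mulr0 add0r; have [Ps|Ps] := boolP (P \in s); first exact: hd.
  by rewrite sA // -vge_ord ?(pev_eq0 QE) // vge_pev // notin_inf_places.
have hB : isdim iota (riemann_roch_space B) [set 0] (n.+1 + (n.+1 - m)).
  have d0' : pev d != 0 by rewrite (pev_eq0 QE).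
  apply: (dim_scale (z := (pev d)^-1) _ _ _
    (rr_multiple_pole_dim m_gt0 QE places S_inf n)); first by rewrite invr_eq0.
    have hv u P : vge P (- B P) ((pev d)^-1 * u) = vge P (- multiple_pole y n P) u.
      by rewrite (vgeMl _ _ _ (ordV P _)) ?invr_eq0 // opprK /B opprD subrK.
    by move=> u; split=> hu P; move: (hv u P) (hu P); rewrite /vge => ->.
  by move=> u; rewrite /=; split => [/eqP|->]; rewrite ?mulr0 // mulf_eq0 invr_eq0 (negPf d0') => /eqP.
have [sB [usB sBA sBB]] := divisor_support hA hB1.
have [P hP|a [ha hle]] := rr_dim_mono finite_degree usB AB _ hB.
  by rewrite (sBA P hP); symmetry; apply: (sBB P hP).
rewrite /riemann_roch_dim (quotient_dimE (subspace0 iota) ha).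
have e : \sum_(P <- sB) (B P - A P) * (place_degree P)%:Z =
    divisor_degree B - divisor_degree A.
  rewrite (supported_on_divisor usB sBA).2 (supported_on_divisor usB sBB).2 -sumrB.
  by apply: eq_bigr => P _; rewrite mulrBl.
move: hle; rewrite e hB2 hn2 hd2 addr0.
have : (m <= n)%N by rewrite /n -addnA leq_addr.
by move: (n) (divisor_degree A); clear => n g mn; lia.
Qed.

Lemma curve_genus : is_genus iota (m%:Z - 1).
Proof.
split; last exact: riemann_inequality.
(* For n = m - 1 the degree is 2 (m - 1) and the dimension is m, so the value is m - 1. *)
have [h1 h2] := multiple_pole_degree m.-1; exists (multiple_pole y m.-1); split => //.
rewrite h2 /riemann_roch_dim.
rewrite (quotient_dimE (subspace0 iota) (rr_multiple_pole_dim m_gt0 QE places S_inf m.-1)).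
by move: m_gt0; clear; lia.
Qed.

Lemma pole_divisor_degree :
  is_divisor (pole_divisor (iota := iota) y) /\ divisor_degree (pole_divisor (iota := iota) y) = 2.
Proof.
have -> : pole_divisor y = multiple_pole (iota := iota) y 1.
  by apply/funext => P; rewrite /multiple_pole mul1r.
by have [h1 ->] := multiple_pole_degree 1; rewrite mul1r.
Qed.

Lemma quadratic_transcendental : transcendental iota y.
Proof. by move=> [p p0 /rootP /eqP]; rewrite -/(pev p) (pev_eq0 QE) (negPf p0). Qed.

Lemma curve_function_field : function_field iota.
Proof.
split; last by move=> z; apply: (curve_constants m_gt0 QE places S_inf).
exists y; split; first exact: quadratic_transcendental.
exists 2%N, (fun i => if i == 0 then 1 else x) => z.
have [f [g [d [d0 ->]]]] := quad_gen QE z.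
exists (fun i => if i == 0 then pev f / pev d else pev g / pev d); split.
  by move=> i; case: eqP => _; [exists f, d|exists g, d]; rewrite -/(pev d) (pev_eq0 QE).
by rewrite !big_ord_recl big_ord0 /= addr0 mulr1 mulrDl mulrAC.
Qed.

End CurveGenus.

(** * The fields of the theorem *)

Section Friendly.
Variables (K F : fieldType) (iota : {rmorphism K -> F}).

Lemma normalized_curve_friendly (x y : F) (m : nat) (b1 b2 : K) :
  (0 < m)%N -> m%:R != 0 :> K -> b1 != b2 -> b1 != 0 -> b2 != 0 ->
  transcendental iota x -> generated_by iota x y ->
  (x - iota b1) * (x - iota b2) = y ^+ m * x ->
  m_friendly iota m.
Proof.
move=> m_gt0 mK b12 b10 b20 x_tr gen y_eq.
have QE := curve_quadratic m_gt0 b10 b20 x_tr gen y_eq.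
have places p : irreducible_poly p -> exists S : seq (place iota), places_over x y p S.
  move=> irp; apply: (exists_places_over QE irp) => h.
  exact: curve_smooth.
have [S S_inf] := exists_inf_places m_gt0 QE.
split; first exact: (curve_function_field m_gt0 QE places S_inf).
(* Modulo y the characteristic polynomial is (h - b1)(h - b2), so b1 is a simple root and gives an
   unramified place above y = 0. *)
have [||Q [hQ _ _ _]] := @split_place _ _ _ _ _ _ _ QE 'X (irreducible_X K) b1%:P.
- rewrite dvdp_X_horner /charpoly_value /curve_trace /curve_norm !hornerE.
  rewrite expr0n (gtn_eqF m_gt0) /=; apply/eqP; ring.
- rewrite dvdp_X_horner /curve_trace !hornerE expr0n (gtn_eqF m_gt0) /= addr0.
  by rewrite opprD addrACA subrr add0r subr_eq0.
exists Q; split; first exact: (curve_genus m_gt0 QE places S_inf).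
exists y; split; last exact: pole_divisor_degree S_inf.
by rewrite place_ord ?(curve_y_neq0 QE) //; rewrite pev_X in hQ; rewrite hQ.
Qed.

(** The translation by a3 moves the pole of y^m at x = a3 to 0; it changes neither the generated
    field nor transcendence. *)
Lemma kummer_curve_friendly (x y : F) (m : nat) (a1 a2 a3 : K) :
  (0 < m)%N -> m%:R != 0 :> K -> a1 != a2 -> a1 != a3 -> a2 != a3 ->
  transcendental iota x -> generated_by iota x y ->
  y ^+ m = (x - iota a1) * (x - iota a2) / (x - iota a3) ->
  m_friendly iota m.
Proof.
move=> m_gt0 mK a12 a13 a23 x_tr gen y_eq.
have x0 : x - iota a3 != 0.
  by apply/eqP => /subr0_eq e; apply: x_tr; rewrite e; apply: algebraic_id.
apply: (@normalized_curve_friendly (x - iota a3) y m (a1 - a3) (a2 - a3)) => //.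
- by rewrite (inj_eq (addIr _)).
- by rewrite subr_eq0.
- by rewrite subr_eq0.
- move=> h; apply: x_tr; rewrite -[x](subrK (iota a3)).
  by apply: algebraic_add => //; apply: algebraic_id.
- move=> R hR hc hx hy; apply: gen => //.
  rewrite -[x](subrK (iota a3)); case: hR => [h1 hB _].
  have hN u : u \in R -> - u \in R.
    by move=> hu; rewrite -[- u]add0r; apply: (hB 0 u) => //; rewrite -(subrr 1); apply: (hB 1 1).
  by rewrite -[X in _ + X]opprK; apply: hB => //; apply: hN.
- by rewrite y_eq divfK // !rmorphB; ring.
Qed.

End Friendly.

(** The translation by 1 permutes K, and comparing the sum of all elements before and after gives
    the claim. *)
Lemma card_natr_eq0 (K : finPzRingType) : #|K|%:R = 0 :> K.
Proof.
apply: (addrI (\sum_(a : K) a)); rewrite addr0 [RHS](reindex_inj (addIr 1)) /=.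
by rewrite big_split /= sumr_const.
Qed.

(** A Bezout relation between m and the cardinal of K, read in K, where that cardinal is 0, makes m
    invertible. *)
Lemma coprime_card_natr_neq0 (K : finFieldType) (m : nat) :
  (0 < m)%N -> coprime m #|K| -> m%:R != 0 :> K.
Proof.
move=> m_gt0 cop; apply/eqP => m0; case: (egcdnP #|K| m_gt0) => u v e _.
have := congr1 (fun n : nat => n%:R : K) e.
rewrite natrD !natrM m0 card_natr_eq0 !mulr0 add0r (eqP cop) => /esym/eqP.
by rewrite oner_eq0.
Qed.

(* The hypothesis coprime m #|K| cannot be dropped: if m = p^k * n with p the   *)
(* characteristic of K and n prime to p, then both fields have genus n - 1.     *)
Theorem theorem4p2 (K : finFieldType) (m : nat) (a1 a2 a3 : K)
  (F1 F2 : fieldType)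
  (iota1 : {rmorphism K -> F1}) (iota2 : {rmorphism K -> F2})
  (x1 y1 : F1) (x2 y2 : F2)
  (m_gt0 : (0 < m)%N) (m_coprime : coprime m #|K|)
  (a12 : a1 != a2) (a13 : a1 != a3) (a23 : a2 != a3)
  (x1_tr : transcendental iota1 x1) (F1_gen : generated_by iota1 x1 y1)
  (y1_eq : y1 ^+ m = (x1 - iota1 a1) * (x1 - iota1 a2) / (x1 - iota1 a3))
  (x2_tr : transcendental iota2 x2) (F2_gen : generated_by iota2 x2 y2)
  (y2_eq : y2 ^+ m = (x2 - iota2 a3) / ((x2 - iota2 a1) * (x2 - iota2 a2))) :
  m_friendly iota1 m /\ m_friendly iota2 m.
Proof.
have mK := coprime_card_natr_neq0 m_gt0 m_coprime.
split; first exact: (kummer_curve_friendly m_gt0 mK a12 a13 a23 x1_tr F1_gen y1_eq).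
apply: (kummer_curve_friendly (y := y2^-1) m_gt0 mK a12 a13 a23 x2_tr).
- move=> R hR hc hx hy; apply: F2_gen => //.
  case: (hR) => R1 _ hdiv; rewrite -[y2]invrK -div1r.
  exact: hdiv.
- by rewrite exprVn y2_eq invf_div.
Qed.
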